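(* Let $A$ be a gendo-symmetric algebra and $M$ an $A$-module. (1) $M$ has codominant dimension larger than or equal to $2$ if and only if $\tau(M) \cong \Omega^{2}(M)$. (2) $M$ has dominant dimension larger than or equal to $2$ if and only if $\tau^{-1}(M) \cong \Omega^{-2}(M)$.
   Context: Algebras are finite dimensional, connected and non-semisimple over a field $K$ (and may be assumed basic); modules are finite dimensional right modules. $D=\operatorname{Hom}_K(-,K)$. $\tau$ and $\tau^{-1}$ are the Auslander-Reiten translates, $\Omega$ and $\Omega^{-1}$ denote syzygy and cosyzygy (taken with respect to minimal projective resp. injective (co)resolutions). An algebra $B$ is symmetric if $B\cong D(B)$ as $B$-bimodules. An algebra $A$ is gendo-symmetric if $A \cong \operatorname{End}_B(N)$ for a symmetric algebra $B$ and a generator $N$ of $\operatorname{mod-}B$. The dominant dimension of a module $M$ with minimal injective coresolution $0 \to M \to I_0 \to I_1 \to \cdots$ is the smallest $n\ge0$ such that $I_n$ is not projective, and is infinite if no such $n$ exists. The codominant dimension of $M$ is the dominant dimension of $D(M)$.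
   Formalization: Part (1) is proved for M all of whose projective direct summands are injective, part (2) for M all of whose injective direct summands are projective; without this, M projective and not injective (dually, injective and not projective) is a counterexample. *)

(* Defs.v *)
(* Modules are finite dimensional right modules over A : falgType K; left
   A-modules are right modules over the opposite algebra A^c. *)
From HB Require Import structures.
From mathcomp Require Import all_boot all_order all_algebra all_field.

Set Implicit Arguments.
Unset Strict Implicit.
Unset Printing Implicit Defensive.

Import GRing.Theory.
Local Open Scope ring_scope.

(* MathComp gives A^c its ring structure but not its algebra structure. The
   arguments of the axioms are pinned to A: left to unification, products of
   elements of A^c may be read in A. *)
Section OppositeAlgebra.
Variables (K : fieldType) (A : falgType K).

HB.instance Definition _ := Vector.copy A^c A.
HB.instance Definition _ := GRing.Lmodule_isLalgebra.Build K A^c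
  (fun k x y => @scalerAr K A k y x).
HB.instance Definition _ := GRing.Lalgebra_isAlgebra.Build K A^c
  (fun k x y => @scalerAl K A k y x).

End OppositeAlgebra.

Lemma linfunE (K : fieldType) (U V : vectType K) (f : U -> V) :
  linear f -> linfun f =1 f.
Proof.
move=> lin_f u; pose lf := GRing.isLinear.Build _ _ _ _ f lin_f.
pose f' : {linear U -> V} := HB.pack f lf.
exact: (lfunE f').
Qed.

Record rmodule (K : fieldType) (A : falgType K) := RModule {
  rcarrier :> vectType K;
  ract : rcarrier -> A -> rcarrier;
  ract_linearl : forall a, linear (ract^~ a);
  ract_linearr : forall v, linear (ract v);
  ract1 : forall v, ract v 1 = v;
  ractM : forall v a b, ract v (a * b) = ract (ract v a) b
}.

Notation "v *> a" := (ract v a) (at level 40, left associativity) : ring_scope.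

Section Modules.
Variables (K : fieldType) (A : falgType K).
Implicit Types M N P I X Y : rmodule A.

Definition is_rhom M N (f : 'Hom(M, N)) : Prop :=
  forall v a, f (v *> a) = f v *> a.

Definition rmod_iso M N : Prop :=
  exists f : 'Hom(M, N), [/\ is_rhom f, lker f = 0%VS & limg f = fullv].

Definition submodule M (U : {vspace M}) : Prop :=
  forall v a, v \in U -> v *> a \in U.

Definition superfluous M (U : {vspace M}) : Prop :=
  forall V : {vspace M}, submodule V -> (U + V)%VS = fullv -> V = fullv.

Definition essential M (U : {vspace M}) : Prop :=
  forall V : {vspace M}, submodule V -> (U :&: V)%VS = 0%VS -> V = 0%VS.

(* Direct summands enter the main statement to exclude projective non-injective
   (dually, injective non-projective) summands: for projective P, tau(P) and
   Omega^2(P) are both 0, whatever the codominant dimension of P is. *)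
Definition rsummand P M : Prop :=
  exists (s : 'Hom(P, M)) (r : 'Hom(M, P)),
    [/\ is_rhom s, is_rhom r & (r \o s)%VF = \1%VF].

Definition rprojective P : Prop :=
  forall X Y (g : 'Hom(X, Y)) (f : 'Hom(P, Y)),
    is_rhom g -> is_rhom f -> limg g = fullv ->
    exists2 h : 'Hom(P, X), is_rhom h & (g \o h)%VF = f.

Definition rinjective I : Prop :=
  forall X Y (g : 'Hom(X, Y)) (f : 'Hom(X, I)),
    is_rhom g -> is_rhom f -> lker g = 0%VS ->
    exists2 h : 'Hom(Y, I), is_rhom h & (h \o g)%VF = f.

Definition projective_cover P M (p : 'Hom(P, M)) : Prop :=
  [/\ rprojective P, is_rhom p, limg p = fullv & superfluous (lker p)].

Definition injective_hull M I (i : 'Hom(M, I)) : Prop :=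
  [/\ rinjective I, is_rhom i, lker i = 0%VS & essential (limg i)].

Record min_inj_coresolution M := MinInjCoresolution {
  coterm : nat -> rmodule A;
  coaug : 'Hom(M, coterm 0);
  codiff : forall n, 'Hom(coterm n, coterm n.+1);
  coaug_hull : injective_hull coaug;
  coterm_inj : forall n, rinjective (coterm n);
  codiff_hom : forall n, is_rhom (codiff n);
  coexact0 : limg coaug = lker (codiff 0);
  coexactS : forall n, limg (codiff n) = lker (codiff n.+1);
  codiff_ess : forall n, essential (limg (codiff n))
}.

(* None is the value infinity. Minimal injective coresolutions are unique up
   to isomorphism, so the value does not depend on the chosen one. *)
Definition is_domdim M (d : option nat) : Prop :=
  exists C : min_inj_coresolution M,
    if d is Some n then
      ~ rprojective (coterm C n) /\ (forall i, (i < n)%N -> rprojective (coterm C i))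
    else forall i, rprojective (coterm C i).

Definition domdim_ge M (n : nat) : Prop :=
  exists2 d, is_domdim M d & if d is Some m then (n <= m)%N else true.

(* The relations below determine X up to isomorphism by n and M. *)
Fixpoint is_syzygy (n : nat) M X : Prop :=
  if n is n'.+1 then
    exists2 Y, is_syzygy n' M Y &
    exists P (p : 'Hom(P, Y)) (i : 'Hom(X, P)),
      [/\ projective_cover p, is_rhom i, lker i = 0%VS & limg i = lker p]
  else rmod_iso M X.

Fixpoint is_cosyzygy (n : nat) M X : Prop :=
  if n is n'.+1 then
    exists2 Y, is_cosyzygy n' M Y &
    exists I (i : 'Hom(Y, I)) (q : 'Hom(I, X)),
      [/\ injective_hull i, is_rhom q, limg q = fullv & lker q = limg i]
  else rmod_iso M X.

Definition racto M (a : A) : 'End(M) := linfun (fun v : M => v *> a).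

Lemma ractoE M a v : racto M a v = v *> a.
Proof. by rewrite linfunE //; apply: ract_linearl. Qed.

Lemma racto_linear M : linear (racto M).
Proof.
by move=> k a b; apply/lfunP=> v; rewrite add_lfunE scale_lfunE !ractoE ract_linearr.
Qed.

HB.instance Definition _ M :=
  GRing.isLinear.Build K A 'End(M) _ (racto M) (@racto_linear M).

(* The space of A-homomorphisms is the kernel of f |-> (a |-> f a - a f). *)
Definition hom_defect M N (f : 'Hom(M, N)) : 'Hom(A, 'Hom(M, N)) :=
  linfun (fun a => ((f \o racto M a) - (racto N a \o f))%VF).

Definition homv M N : {vspace 'Hom(M, N)} := lker (linfun (@hom_defect M N)).

Lemma hom_defectE M N (f : 'Hom(M, N)) a v :
  hom_defect f a v = f (v *> a) - f v *> a.
Proof.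
have lin : linear (fun a => ((f \o racto M a) - (racto N a \o f))%VF).
  move=> k x y; apply/lfunP=> w.
  rewrite !(add_lfunE, opp_lfunE, scale_lfunE, comp_lfunE, linearP) /=.
  by rewrite scalerDr addrACA.
rewrite /hom_defect linfunE //.
by rewrite add_lfunE opp_lfunE !comp_lfunE !ractoE.
Qed.

Lemma homvP M N (f : 'Hom(M, N)) : f \in homv M N <-> is_rhom f.
Proof.
have lin : linear (@hom_defect M N).
  move=> k x y; apply/lfunP=> a; apply/lfunP=> v.
  rewrite !(add_lfunE, scale_lfunE, hom_defectE) ract_linearl.
  by rewrite scalerBr opprD addrACA.
rewrite memv_ker linfunE //.
split=> [/eqP f0 v a | fh].
  by apply/eqP; rewrite -subr_eq0 -hom_defectE f0 !zero_lfunE.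
by apply/eqP/lfunP=> a; apply/lfunP=> v; rewrite hom_defectE fh subrr !zero_lfunE.
Qed.

Definition rregular : rmodule A.
Proof.
apply: (@RModule K A A (fun v a => v * a)).
- by move=> a k u v /=; rewrite mulrDl scalerAl.
- by move=> v k a b /=; rewrite mulrDr scalerAr.
- exact: mulr1.
- by move=> v a b; rewrite mulrA.
Defined.

End Modules.

Section Dualities.
Variables (K : fieldType) (A : falgType K).
Implicit Types M P : rmodule A.

Definition rdual_act M (phi : 'Hom(M, K^o)) (a : A^c) : 'Hom(M, K^o) :=
  (phi \o racto M a)%VF.

Definition rdual M : rmodule A^c.
Proof.
apply: (@RModule K A^c 'Hom(M, K^o) (@rdual_act M)).
- move=> a k f g; apply/lfunP=> v.
  by rewrite !(comp_lfunE, add_lfunE, scale_lfunE).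
- move=> f k a b; apply/lfunP=> v.
  by rewrite !(comp_lfunE, add_lfunE, scale_lfunE) ractoE ract_linearr linearP -!ractoE.
- by move=> f; apply/lfunP=> v; rewrite comp_lfunE ractoE ract1.
- move=> f a b; apply/lfunP=> v.
  by rewrite !comp_lfunE !ractoE [v *> _](@ractM _ _ M v b a).
Defined.

(* Hom_A(P, A) is the left A-module with (a f)(x) = a * f x. *)
Definition homA_act P (f : subvs_of (homv P (rregular A))) (a : A^c) :
    subvs_of (homv P (rregular A)) :=
  vsproj (homv P (rregular A)) (amull (a : A) \o vsval f)%VF.

Lemma homA_actE P f a x :
  vsval (@homA_act P f a) x = (a : A) * (vsval f x : A).
Proof.
rewrite vsprojK ?comp_lfunE ?lfunE //; apply/homvP=> v b.
by rewrite !comp_lfunE !lfunE /= ((homvP _).1 (valP f)) /= mulrA.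
Qed.

Definition homA P : rmodule A^c.
Proof.
apply: (@RModule K A^c (subvs_of (homv P (rregular A))) (@homA_act P)).
- move=> a k f g; apply: val_inj; apply/lfunP=> v.
  rewrite homA_actE ![vsval _]linearP !(add_lfunE, scale_lfunE, homA_actE).
  by rewrite mulrDr scalerAr.
- move=> f k a b; apply: val_inj; apply/lfunP=> v.
  rewrite homA_actE [in RHS]linearP !(add_lfunE, scale_lfunE, homA_actE).
  by rewrite mulrDl scalerAl.
- by move=> f; apply: val_inj; apply/lfunP=> v; rewrite homA_actE mul1r.
- move=> f a b; apply: val_inj; apply/lfunP=> v.
  by rewrite !homA_actE mulrA.
Defined.

(* T is the transpose of M: the cokernel of Hom_A(P0, A) -> Hom_A(P1, A) for a
   minimal projective presentation P1 -> P0 -> M -> 0. *)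
Definition is_transpose M (T : rmodule A^c) : Prop :=
  exists (P0 P1 : rmodule A) (p : 'Hom(P0, M)) (f : 'Hom(P1, P0))
         (q : 'Hom(homA P1, T)),
    [/\ projective_cover p,
        [/\ rprojective P1, is_rhom f, limg f = lker p & superfluous (lker f)]
      & [/\ is_rhom q, limg q = fullv &
            forall h : homA P1, q h = 0 <->
              exists g : homA P0, vsval h = (vsval g \o f)%VF]].

(* A^c^c and A have the same carrier and convertible products, but are not
   convertible as algebras. *)
Definition of_opop (M : rmodule A^c^c) : rmodule A :=
  @RModule K A M (fun v a => ract v (a : A^c^c))
    (@ract_linearl _ _ M) (@ract_linearr _ _ M) (@ract1 _ _ M) (@ractM _ _ M).

End Dualities.

Section AuslanderReiten.
Variables (K : fieldType) (A : falgType K).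
Implicit Types M X : rmodule A.

Definition is_tau M X : Prop :=
  exists2 T : rmodule A^c, is_transpose M T & rmod_iso X (of_opop (rdual T)).

Definition is_tau_inv M X : Prop :=
  exists2 T : rmodule A^c^c, is_transpose (rdual M) T & rmod_iso X (of_opop T).

Definition codomdim_ge M (n : nat) : Prop := domdim_ge (rdual M) n.

End AuslanderReiten.

Section Algebras.
Variables (K : fieldType).
Implicit Types A B : falgType K.

Definition connected_alg A : Prop :=
  forall e : A, e * e = e -> (forall a, a * e = e * a) -> e = 0 \/ e = 1.

Definition semisimple_alg A : Prop :=
  forall U : {vspace rregular A}, submodule U ->
    exists V : {vspace rregular A},
      [/\ submodule V, (U + V)%VS = fullv & (U :&: V)%VS = 0%VS].

(* phi is an isomorphism of bimodules B -> D(B), where D(B) has the bimodule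
   structure (a f b)(y) = f (b y a). *)
Definition symmetric_alg B : Prop :=
  exists phi : 'Hom(B, 'Hom(B, K^o)),
    [/\ lker phi = 0%VS, limg phi = fullv &
        forall a b x y : B, phi (a * x * b) y = phi x (b * y * a)].

(* Every module is a quotient of some N^k. *)
Definition generator B (N : rmodule B) : Prop :=
  forall X : rmodule B, exists (k : nat) (f : 'I_k -> 'Hom(N, X)),
    (forall i, is_rhom (f i)) /\ (\sum_(i < k) limg (f i))%VS = fullv.

Definition is_End_alg A B (N : rmodule B) : Prop :=
  exists phi : A -> 'End(N),
    [/\ linear phi, injective phi,
        phi 1 = \1%VF /\ (forall a b, phi (a * b) = (phi a \o phi b)%VF)
      & forall f, is_rhom f <-> exists a, f = phi a].

Definition gendo_symmetric A : Prop :=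
  exists (B : falgType K) (N : rmodule B),
    [/\ symmetric_alg B, generator N & is_End_alg A N].

End Algebras.

(* Main.v *)
Require Import Defs.
From mathcomp Require Import all_boot all_order all_algebra all_field.
From Stdlib Require Import Classical ClassicalEpsilon.

(** Write Q for D(N), a right module over A = End_B(N), where B is symmetric and
    N is a generator. As B is symmetric, D(N) = Hom_B(N, B), and as N is a
    generator, N is projective over A on the left and Hom_B(N, B) on the right;
    hence Q is projective and injective. Evaluation
    D(A) = N (x)_B Hom_B(N, B) -> End_B(N) = A is a map of A-bimodules, and so
    gives a map D(P) -> Hom_A(P, A) of left modules, natural in P. It is
    bijective for P = Q, hence for powers of Q and their summands, and these
    summands are the projective-injective modules, because every projective
    module embeds into a power of Q. That is all that is used of A
    (nakayama_datum).

    The codominant dimension of M is at least 2 exactly when both terms of its minimal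
    projective presentation f : P1 -> P0 -> M are injective
    (proj_inj_presented; passing to D(M) is codomdim_ge2P). If so, Hom_A(f, A)
    is isomorphic to D(f), thus the transpose of M is the cokernel of D(f),
    which is D(ker f), and tau(M) = ker f = Omega^2(M)
    (tau_of_proj_inj_presented).

    Conversely let tau(M) = Omega^2(M) = Y. The kernel Y of a map between
    projective modules is reflexive with respect to Q, because A is, so there is
    an exact sequence 0 -> Y -> Q^n -> Q^m (second_syzygy_copresented). Through
    D(Q^n) = Hom_A(Q^n, A) it becomes a second projective presentation of the
    transpose D(Y), besides Hom_A(P0, A) -> Hom_A(P1, A). The comparison maps of
    the two presentations show that P1 is a summand of Q^n and that w f = f for
    an endomorphism w of P0 that factors through Q^m. If w has minimal
    rank, P0 is the sum of the image of w, on which w is invertible and which is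
    thus a summand of Q^m, and of the kernel of w; the projection onto the
    kernel vanishes on the image of f and so factors through M. The kernel is
    then a projective summand of M, and is injective by assumption
    (injective_of_factor). So P0 and P1 are injective
    (proj_inj_presented_of_tau).

    The statement on dominant dimension is the one on codominant dimension for
    D(M) over the opposite algebra, which is again gendo-symmetric: it is the
    endomorphism algebra of D(N) over the opposite of B
    (gendo_symmetric_op, tau_inv_cosyzygy_dual). *)
Set Implicit Arguments.
Unset Strict Implicit.
Unset Printing Implicit Defensive.

Import GRing.Theory.
Local Open Scope ring_scope.

(** * Linear maps *)

Section LinearMaps.
Variable K : fieldType.
Implicit Types U V W : vectType K.

(** Most homomorphisms below are determined by a condition on pairs (u, v) and
    have no convenient formula; linearity is then that of the condition. *)
Lemma hom_of_rel U V (R : U -> V -> Prop) :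
    (forall u, exists v, R u v) -> (forall v, R 0 v -> v = 0) ->
    (forall k u v u' v', R u v -> R u' v' -> R (k *: u + u') (k *: v + v')) ->
  exists F : 'Hom(U, V), forall u, R u (F u).
Proof.
move=> tot R0 lin.
pose F u := proj1_sig (constructive_indefinite_description _ (tot u)).
have FP u : R u (F u) by rewrite /F; case: constructive_indefinite_description.
have Fu u v : R u v -> v = F u.
  move=> Ruv; apply/eqP; rewrite -subr_eq0; apply/eqP/R0.
  have := lin (-1) _ _ _ _ (FP u) Ruv.
  by rewrite scaleN1r addNr scaleN1r addrC.
have Flin : linear F by move=> k u v; rewrite -(Fu _ _ (lin k _ _ _ _ (FP u) (FP v))).
by exists (linfun F) => u; rewrite linfunE.
Qed.

Lemma hom_extend U V W (j : 'Hom(U, V)) (g : 'Hom(U, W)) :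
  (lker j <= lker g)%VS -> exists h : 'Hom(V, W), g = (h \o j)%VF.
Proof.
move=> /subvP jg; exists (g \o j^-1)%VF; apply/lfunP=> u; rewrite !comp_lfunE.
apply/eqP; rewrite -subr_eq0 -linearB -memv_ker; apply: jg.
by rewrite memv_ker linearB /= limg_lfunVK ?memv_img ?memvf // subrr.
Qed.

Lemma separate V (U : {vspace V}) x :
    (forall phi : 'Hom(V, K^o), (forall u, u \in U -> phi u = 0) -> phi x = 0) ->
  x \in U.
Proof.
move=> sep; suff -> : x = projv U x by apply: memv_proj.
apply/eqP; rewrite -subr_eq0; apply/eqP.
rewrite (coord_vbasis (memvf (x - projv U x))) big1 // => i _.
suff -> : coord (vbasis fullv) i (x - projv U x) = 0 by rewrite scale0r.
pose c y : K^o := coord (vbasis fullv) i (y - projv U y).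
have cl : linear c.
  by move=> k y z; rewrite /c linearP opprD addrACA -scalerBr linearP.
rewrite -/(c x) -(linfunE cl); apply: sep => u uU.
by rewrite linfunE // /c projv_id // subrr linear0.
Qed.

Lemma separate0 V (x : V) : (forall phi : 'Hom(V, K^o), phi x = 0) -> x = 0.
Proof.
by move=> sep; apply/eqP; rewrite -memv0; apply: separate => phi _; apply: sep.
Qed.

Lemma lker0_inj U V (f : 'Hom(U, V)) u : lker f = 0%VS -> f u = 0 -> u = 0.
Proof. by move=> f0 fu; apply/eqP; rewrite -memv0 -f0 memv_ker fu. Qed.

Lemma inj_lker0 U V (f : 'Hom(U, V)) : (forall u, f u = 0 -> u = 0) -> lker f = 0%VS.
Proof.
move=> inj; apply/eqP; rewrite -subv0; apply/subvP=> u.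
by rewrite memv_ker => /eqP/inj->; rewrite memv0.
Qed.

Lemma limg_fullP U V (f : 'Hom(U, V)) :
  limg f = fullv <-> forall v, exists u, f u = v.
Proof.
split=> [f1 v | sur].
  by have /memv_imgP[u _ ->] : v \in limg f; [rewrite f1 memvf | exists u].
apply/vspaceP=> v; rewrite memvf; have [u <-] := sur v.
by rewrite memv_img ?memvf.
Qed.

Lemma mem_limg U V (f : 'Hom(U, V)) v : v \in limg f <-> exists u, f u = v.
Proof.
split=> [/memv_imgP[u _ ->] | [u <-]]; first by exists u.
by rewrite memv_img ?memvf.
Qed.

Lemma lker0_full V (f : 'End(V)) : lker f = 0%VS <-> limg f = fullv.
Proof.
split=> [f0 | f1]; move: (limg_ker_dim f fullv); rewrite capfv.
  rewrite f0 dimv0 add0n => d; apply/eqP.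
  by rewrite -(geq_leqif (dimv_leqif_eq (subvf _))) d.
by rewrite f1 => /eqP; rewrite -[X in _ == X]add0n eqn_add2r dimv_eq0 => /eqP.
Qed.

End LinearMaps.

(** * Homomorphisms, submodules and powers *)

Section ModuleBasics.
Variables (K : fieldType) (A : falgType K).
Implicit Types M N P Q W X Y Z : rmodule A.

Lemma ract0 M (a : A) : (0 : M) *> a = 0.
Proof. by rewrite -ractoE linear0. Qed.

Lemma ractD M (u v : M) (a : A) : (u + v) *> a = u *> a + v *> a.
Proof. by rewrite -!ractoE linearD. Qed.

Lemma ractZ M k (u : M) (a : A) : (k *: u) *> a = k *: (u *> a).
Proof. by rewrite -!ractoE linearZ. Qed.

Lemma ract_sum M I (r : seq I) (F : I -> M) (a : A) :
  (\sum_(i <- r) F i) *> a = \sum_(i <- r) F i *> a.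
Proof. rewrite -ractoE linear_sum; apply: eq_bigr => i _; exact: ractoE. Qed.

Lemma ract_linr M (v : M) k (a b : A) : v *> (k *: a + b) = k *: (v *> a) + v *> b.
Proof. exact: ract_linearr. Qed.

Lemma ractr0 M (v : M) : v *> 0 = 0.
Proof. by rewrite -ractoE linear0 zero_lfunE. Qed.

Lemma ract_sumr M I (r : seq I) (F : I -> A) (v : M) :
  v *> (\sum_(i <- r) F i) = \sum_(i <- r) v *> F i.
Proof.
rewrite -ractoE linear_sum sum_lfunE.
by apply: eq_bigr => i _; rewrite ractoE.
Qed.

Lemma rhom_comp X Y Z (f : 'Hom(X, Y)) (g : 'Hom(Y, Z)) :
  is_rhom f -> is_rhom g -> is_rhom (g \o f)%VF.
Proof. by move=> fh gh v a; rewrite !comp_lfunE fh gh. Qed.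

Lemma rhom_id X : is_rhom (\1%VF : 'End(X)).
Proof. by move=> v a; rewrite !id_lfunE. Qed.

Lemma rhom_lin X Y k (f g : 'Hom(X, Y)) :
  is_rhom f -> is_rhom g -> is_rhom (k *: f + g).
Proof.
by move=> fh gh v a; rewrite !(add_lfunE, scale_lfunE) fh gh ractD ractZ.
Qed.

Lemma rhomB X Y (f g : 'Hom(X, Y)) : is_rhom f -> is_rhom g -> is_rhom (f - g).
Proof.
by move=> fh gh; rewrite addrC -scaleN1r; apply: rhom_lin.
Qed.

Lemma rhom0 X Y : is_rhom (0 : 'Hom(X, Y)).
Proof. by move=> v a; rewrite !zero_lfunE ract0. Qed.

Lemma rhom_sum X Y I (r : seq I) (F : I -> 'Hom(X, Y)) :
  (forall i, is_rhom (F i)) -> is_rhom (\sum_(i <- r) F i).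
Proof.
move=> Fh; elim: r => [|i r IH]; first by rewrite big_nil; apply: rhom0.
by rewrite big_cons -[F i]scale1r; apply: rhom_lin.
Qed.

Lemma rhom_inv X Y (e : 'Hom(X, Y)) :
  is_rhom e -> lker e = 0%VS -> limg e = fullv -> is_rhom (e^-1)%VF.
Proof.
move=> eh e0 e1 v a; have [u <-] := (limg_fullP e).1 e1 v.
by rewrite -eh !lker0_lfunK ?e0.
Qed.

Lemma rhom_of_rel X Y (R : X -> Y -> Prop) :
    (forall u, exists v, R u v) -> (forall v, R 0 v -> v = 0) ->
    (forall k u v u' v', R u v -> R u' v' -> R (k *: u + u') (k *: v + v')) ->
    (forall u v a, R u v -> R (u *> a) (v *> a)) ->
  exists2 F : 'Hom(X, Y), is_rhom F & forall u, R u (F u).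
Proof.
move=> tot R0 lin act; have [F FP] := hom_of_rel tot R0 lin.
exists F => // v a; apply/eqP; rewrite -subr_eq0; apply/eqP/R0.
by have := lin (-1) _ _ _ _ (act _ _ a (FP v)) (FP (v *> a)); rewrite !scaleN1r addNr addrC.
Qed.

Lemma submodule_limg X Y (f : 'Hom(X, Y)) : is_rhom f -> submodule (limg f).
Proof.
move=> fh v a /mem_limg[u <-]; rewrite -fh; apply/mem_limg; by exists (u *> a).
Qed.

Lemma submodule_lker X Y (f : 'Hom(X, Y)) : is_rhom f -> submodule (lker f).
Proof.
by move=> fh v a; rewrite !memv_ker fh => /eqP->; rewrite ract0.
Qed.

(** Kernels and images have to be modules in their own right to be the source
    of homomorphisms and to count as syzygies. *)
Lemma submodule_embedding X (U : {vspace X}) :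
  submodule U -> exists Y (i : 'Hom(Y, X)), [/\ is_rhom i, lker i = 0%VS & limg i = U].
Proof.
move=> subU.
pose act (u : subvs_of U) (a : A) : subvs_of U := vsproj U (vsval u *> a).
have actE u a : vsval (act u a) = vsval u *> a by rewrite vsprojK ?subU ?subvsP.
have l1 a : linear (act^~ a).
  by move=> k u v; apply: val_inj => /=; rewrite actE !linearP /= !actE ract_linearl.
have l2 u : linear (act u).
  by move=> k a b; apply: val_inj => /=; rewrite !actE ract_linr.
have l3 u : act u 1 = u by apply: val_inj => /=; rewrite actE ract1.
have l4 u a b : act u (a * b) = act (act u a) b.
  by apply: val_inj => /=; rewrite !actE ractM.
pose Y := RModule l1 l2 l3 l4.
have lv : linear (fun u : Y => vsval u : X) by move=> k u v; rewrite linearP.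
exists Y, (linfun (fun u : Y => vsval u : X)); split.
- by move=> u a; rewrite !linfunE // actE.
- by apply: inj_lker0 => u; rewrite linfunE // => u0; apply: val_inj.
- apply/vspaceP=> x; apply/idP/idP=> [/mem_limg[u <-] | xU].
    by rewrite linfunE // subvsP.
  by apply/mem_limg; exists (vsproj U x : Y); rewrite linfunE // vsprojK.
Qed.

Lemma rhom_factor_inj X Y Z (i : 'Hom(Y, X)) (f : 'Hom(Z, X)) :
    is_rhom i -> lker i = 0%VS -> is_rhom f -> (limg f <= limg i)%VS ->
  exists2 f' : 'Hom(Z, Y), is_rhom f' & (i \o f')%VF = f.
Proof.
move=> ih i0 fh /subvP fi.
have [||||f' f'h f'P] := @rhom_of_rel Z Y (fun z y => i y = f z).
- by move=> z; apply/mem_limg/fi/mem_limg; exists z.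
- by move=> y; rewrite linear0 => /(lker0_inj i0).
- by move=> k u v u' v' /= e e'; rewrite !linearP /= e e'.
- by move=> u v a /= e; rewrite ih fh e.
by exists f' => //; apply/lfunP=> z; rewrite comp_lfunE.
Qed.

Lemma rhom_factor_surj X Y Z (p : 'Hom(X, Y)) (f : 'Hom(X, Z)) :
    is_rhom p -> limg p = fullv -> is_rhom f -> (lker p <= lker f)%VS ->
  exists2 f' : 'Hom(Y, Z), is_rhom f' & (f' \o p)%VF = f.
Proof.
move=> ph p1 fh pf; have [f' fE] := hom_extend pf; exists f' => // y a.
have [x <-] := (limg_fullP p).1 p1 y.
by rewrite -ph -!comp_lfunE -fE fh.
Qed.

Section Power.
Variables (n : nat) (M : rmodule A).

Definition pow_act (v : {ffun 'I_n -> M}) (a : A) : {ffun 'I_n -> M} :=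
  [ffun i => v i *> a].

Definition rpow : rmodule A.
Proof.
apply: (@RModule K A {ffun 'I_n -> M} pow_act).
- by move=> a k u v; apply/ffunP=> i; rewrite !ffunE ract_linearl.
- by move=> v k a b; apply/ffunP=> i; rewrite !ffunE ract_linr.
- by move=> v; apply/ffunP=> i; rewrite !ffunE ract1.
- by move=> v a b; apply/ffunP=> i; rewrite !ffunE ractM.
Defined.

Lemma rpow_proj (i : 'I_n) :
  exists2 p : 'Hom(rpow, M), is_rhom p & forall v : rpow, p v = v i.
Proof.
have l : linear (fun v : rpow => v i) by move=> k u v; rewrite !ffunE.
exists (linfun (fun v : rpow => v i)) => [v a|v]; rewrite !linfunE //.
by rewrite ffunE.
Qed.

Lemma rpow_pair X (h : 'I_n -> 'Hom(X, M)) : (forall i, is_rhom (h i)) ->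
  exists2 F : 'Hom(X, rpow), is_rhom F & forall x i, (F x : {ffun 'I_n -> M}) i = h i x.
Proof.
move=> hh; pose f (x : X) : rpow := [ffun i => h i x].
have l : linear f by move=> k u v; apply/ffunP=> i; rewrite !ffunE linearP.
exists (linfun f) => [v a|x i]; rewrite !linfunE ?ffunE //.
by apply/ffunP=> i; rewrite !ffunE hh.
Qed.

Lemma rpow_copair X (h : 'I_n -> 'Hom(M, X)) : (forall i, is_rhom (h i)) ->
  exists2 F : 'Hom(rpow, X), is_rhom F &
    forall v : rpow, F v = \sum_i h i ((v : {ffun 'I_n -> M}) i).
Proof.
move=> hh; pose f (v : rpow) := \sum_i h i ((v : {ffun 'I_n -> M}) i).
have l : linear f.
  move=> k u v; rewrite /f scaler_sumr -big_split; apply: eq_bigr => i _.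
  by rewrite !ffunE linearP.
exists (linfun f) => [v a|x]; rewrite !linfunE // /f ract_sum.
by apply: eq_bigr => i _; rewrite !ffunE hh.
Qed.

Lemma rpow_inj (i : 'I_n) :
  exists2 p : 'Hom(M, rpow), is_rhom p &
    forall x j, (p x : {ffun 'I_n -> M}) j = if j == i then x else 0.
Proof.
have [|F Fh FP] := @rpow_pair M (fun j => if j == i then \1%VF else 0).
  by move=> j; case: ifP => _; [apply: rhom_id | apply: rhom0].
by exists F => // x j; rewrite FP; case: ifP => _; rewrite ?id_lfunE ?zero_lfunE.
Qed.

End Power.

(** Finite dimension of Hom(X, Q) lets a single map into a power of Q, with
    components a basis of H, stand for the whole space H. *)
Lemma rhoms_as_one X Q (H : {vspace 'Hom(X, Q)}) :
    (forall h, h \in H -> is_rhom h) ->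
  exists2 F : 'Hom(X, rpow (\dim H) Q), is_rhom F &
    forall x i, (F x : {ffun 'I_(\dim H) -> Q}) i = (vbasis H)`_i x.
Proof.
move=> Hh; apply: (@rpow_pair _ _ X (fun i : 'I_(\dim H) => (vbasis H)`_i)) => i.
by apply/Hh/vbasis_mem/mem_nth; rewrite size_tuple.
Qed.

Lemma rhoms_as_one_eq0 X Q (H : {vspace 'Hom(X, Q)})
    (F : 'Hom(X, rpow (\dim H) Q)) x :
    (forall x i, (F x : {ffun 'I_(\dim H) -> Q}) i = (vbasis H)`_i x) ->
  F x = 0 <-> forall h, h \in H -> h x = 0.
Proof.
move=> FE; split=> [Fx h hH | hx].
  rewrite (coord_vbasis hH) sum_lfunE big1 // => i _.
  by rewrite scale_lfunE -FE Fx ffunE scaler0.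
apply/ffunP=> i; rewrite FE ffunE; apply/hx/vbasis_mem/mem_nth.
by rewrite size_tuple.
Qed.

End ModuleBasics.

(** * Projective and injective modules *)

Section ProjectiveInjective.
Variables (K : fieldType) (A : falgType K).
Implicit Types M N P Q W X Y Z : rmodule A.

Lemma projective_summand P Q (s : 'Hom(P, Q)) (r : 'Hom(Q, P)) :
    is_rhom s -> is_rhom r -> (forall x, r (s x) = x) ->
  rprojective Q -> rprojective P.
Proof.
move=> sh rh rs projQ X Y g f gh fh g1.
have [h hh hE] := projQ X Y g (f \o r)%VF gh (rhom_comp rh fh) g1.
exists (h \o s)%VF; first exact: rhom_comp.
by rewrite comp_lfunA hE; apply/lfunP=> x; rewrite !comp_lfunE rs.
Qed.

Lemma injective_summand P Q (s : 'Hom(P, Q)) (r : 'Hom(Q, P)) :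
    is_rhom s -> is_rhom r -> (forall x, r (s x) = x) ->
  rinjective Q -> rinjective P.
Proof.
move=> sh rh rs injQ X Y g f gh fh g1.
have [h hh hE] := injQ X Y g (s \o f)%VF gh (rhom_comp fh sh) g1.
exists (r \o h)%VF; first exact: rhom_comp.
by rewrite -comp_lfunA hE; apply/lfunP=> x; rewrite !comp_lfunE rs.
Qed.

Lemma rpow_sum n Q (v : rpow n Q) (j : 'I_n -> 'Hom(Q, rpow n Q)) :
    (forall i x k, (j i x : {ffun 'I_n -> Q}) k = if k == i then x else 0) ->
  v = \sum_i j i ((v : {ffun 'I_n -> Q}) i).
Proof.
move=> jE; apply/ffunP=> k; rewrite sum_ffunE (bigD1 k) //= jE eqxx big1 ?addr0 //.
by move=> i ik; rewrite jE eq_sym (negPf ik).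
Qed.

Lemma rpow_injs n Q : exists2 j : 'I_n -> 'Hom(Q, rpow n Q),
  forall i, is_rhom (j i) &
  forall i x k, (j i x : {ffun 'I_n -> Q}) k = if k == i then x else 0.
Proof.
have /fin_all_exists[j jP] : forall i : 'I_n, exists j : 'Hom(Q, rpow n Q),
    is_rhom j /\ forall x k, (j x : {ffun 'I_n -> Q}) k = if k == i then x else 0.
  by move=> i; have [j jh jE] := rpow_inj Q i; exists j.
by exists j => i; [exact: (jP i).1 | exact: (jP i).2].
Qed.

Lemma projective_rpow n Q : rprojective Q -> rprojective (rpow n Q).
Proof.
move=> projQ X Y g f gh fh g1; have [j jh jE] := rpow_injs n Q.
have /fin_all_exists[h hP] : forall i : 'I_n, exists h : 'Hom(Q, X),
    is_rhom h /\ (g \o h = f \o j i)%VF.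
  move=> i; have [h hh hE] := projQ X Y g (f \o j i)%VF gh (rhom_comp (jh i) fh) g1.
  by exists h.
have [F Fh FE] := rpow_copair (fun i => (hP i).1); exists F => //.
apply/lfunP=> v; rewrite comp_lfunE FE linear_sum {2}(rpow_sum v jE) linear_sum.
apply: eq_bigr => i _ /=.
by rewrite -[LHS](comp_lfunE g) (hP i).2 comp_lfunE.
Qed.

Lemma injective_rpow n Q : rinjective Q -> rinjective (rpow n Q).
Proof.
move=> injQ X Y g f gh fh g1.
have /fin_all_exists[h hP] : forall i : 'I_n, exists h : 'Hom(Y, Q),
    is_rhom h /\ forall x, h (g x) = (f x : {ffun 'I_n -> Q}) i.
  move=> i; have [p ph pE] := rpow_proj Q i.
  have [h hh hE] := injQ X Y g (p \o f)%VF gh (rhom_comp fh ph) g1.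
  by exists h; split=> // x; rewrite -comp_lfunE hE comp_lfunE pE.
have [F Fh FE] := rpow_pair (fun i => (hP i).1); exists F => //.
by apply/lfunP=> x; apply/ffunP=> i; rewrite comp_lfunE FE (hP i).2.
Qed.

Lemma rhom_from_regular M (x : M) :
  exists2 F : 'Hom(rregular A, M), is_rhom F & forall a : A, F a = x *> a.
Proof.
have l : linear (fun a : rregular A => x *> (a : A)) by move=> k a b; apply: ract_linr.
exists (linfun (fun a : rregular A => x *> (a : A))) => [a b|a]; rewrite !linfunE //.
by rewrite -ractM.
Qed.

(** A splitting of the surjection from the free module on a K-basis of P. *)
Lemma dual_basis P : rprojective P ->
  exists n (x : 'I_n -> P) (g : 'I_n -> 'Hom(P, rregular A)),
    (forall i, is_rhom (g i)) /\ forall y, y = \sum_i x i *> (g i y : A).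
Proof.
move=> projP; pose n := \dim {:P}; pose x (i : 'I_n) := (vbasis {:P})`_i.
have /fin_all_exists[h hP] : forall i : 'I_n, exists h : 'Hom(rregular A, P),
    is_rhom h /\ forall a : A, h a = x i *> a.
  by move=> i; have [h hh hE] := rhom_from_regular (x i); exists h.
have [F Fh FE] := rpow_copair (fun i => (hP i).1).
have F1 : limg F = fullv.
  apply/limg_fullP => y.
  exists [ffun i => coord (vbasis {:P}) i y *: 1 : rregular A].
  rewrite FE [y in RHS](coord_vbasis (memvf y)); apply: eq_bigr => i _.
  by rewrite ffunE linearZ /= (hP i).2 ract1.
have [s sh sE] := projP _ _ F \1%VF Fh (@rhom_id _ _ _) F1.
have /fin_all_exists[p pP] : forall i : 'I_n, exists p : 'Hom(rpow n (rregular A), rregular A),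
    is_rhom p /\ forall v : rpow n (rregular A), p v = (v : {ffun 'I_n -> rregular A}) i.
  by move=> i; have [p ph pE] := rpow_proj (rregular A) i; exists p.
exists n, x, (fun i => (p i \o s)%VF); split=> [i | y].
  exact: rhom_comp sh (pP i).1.
rewrite -[LHS](id_lfunE y) -sE comp_lfunE FE; apply: eq_bigr => i _.
by rewrite (hP i).2 comp_lfunE (pP i).2.
Qed.

(** With x from a dual basis of P, such combinations turn data about Hom(P, A)
    into homomorphisms to P. *)
Lemma rhom_expansion n P Z (x : 'I_n -> P) (u : 'I_n -> 'Hom(Z, rregular A)) :
    (forall i, is_rhom (u i)) ->
  exists2 k : 'Hom(Z, P), is_rhom k & forall z, k z = \sum_i x i *> (u i z : A).
Proof.
move=> uh.
have /fin_all_exists[h hP] : forall i : 'I_n, exists h : 'Hom(rregular A, P),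
    is_rhom h /\ forall a : A, h a = x i *> a.
  by move=> i; have [h hh hE] := rhom_from_regular (x i); exists h.
exists (\sum_i (h i \o u i))%VF; last first.
  move=> z; rewrite sum_lfunE; apply: eq_bigr => i _.
  by rewrite comp_lfunE (hP i).2.
by apply: rhom_sum => i; apply: rhom_comp (uh i) (hP i).1.
Qed.

(** A map into a projective module factors as soon as all its composites with
    linear forms do: a dual basis assembles the factorizations. *)
Lemma projective_factor P Z W (F : 'Hom(Z, P)) (d : 'Hom(Z, W)) :
    rprojective P ->
    (forall g : 'Hom(P, rregular A), is_rhom g ->
       exists2 u : 'Hom(W, rregular A), is_rhom u & (g \o F = u \o d)%VF) ->
  exists2 k : 'Hom(W, P), is_rhom k & F = (k \o d)%VF.
Proof.
move=> projP fact; have [n [x [g [gh gE]]]] := dual_basis projP.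
have /fin_all_exists[u uP] : forall i : 'I_n, exists u : 'Hom(W, rregular A),
    is_rhom u /\ (g i \o F = u \o d)%VF.
  by move=> i; have [u uh uE] := fact _ (gh i); exists u.
have [k kh kE] := rhom_expansion x (fun i => (uP i).1); exists k => //.
apply/lfunP=> z; rewrite comp_lfunE kE {1}(gE (F z)); apply: eq_bigr => i _.
by rewrite -comp_lfunE (uP i).2 comp_lfunE.
Qed.

Lemma projective_torsionless P (x : P) : rprojective P ->
  (forall g : 'Hom(P, rregular A), is_rhom g -> g x = 0) -> x = 0.
Proof.
move=> projP gx; have [n [y [g [gh gE]]]] := dual_basis projP.
by rewrite (gE x) big1 // => i _; rewrite gx // ractr0.
Qed.

Section Coinduced.
Variable V : vectType K.

Definition coind_act (h : 'Hom(A, V)) (a : A) : 'Hom(A, V) := (h \o amull a)%VF.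

Definition coinduced : rmodule A.
Proof.
apply: (@RModule K A 'Hom(A, V) coind_act).
- by move=> a k u v; apply/lfunP=> x; rewrite !(comp_lfunE, add_lfunE, scale_lfunE).
- move=> v k a b; apply/lfunP=> x; rewrite !(comp_lfunE, add_lfunE, scale_lfunE).
  by rewrite !lfunE /= mulrDl -scalerAl linearP.
- by move=> v; apply/lfunP=> x; rewrite comp_lfunE lfunE /= mul1r.
- by move=> v a b; apply/lfunP=> x; rewrite !comp_lfunE !lfunE /= mulrA.
Defined.

Lemma coinducedE (h : coinduced) (a x : A) :
  ((h *> a : coinduced) : 'Hom(A, V)) x = (h : 'Hom(A, V)) (a * x).
Proof. by rewrite comp_lfunE lfunE. Qed.

(** Coinduction is right adjoint to the forgetful functor to vector spaces, so
    coinduced modules are injective because vector spaces are. *)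
Lemma rhom_coinduced X (l : 'Hom(X, V)) :
  exists2 F : 'Hom(X, coinduced), is_rhom F &
    forall x (a : A), (F x : 'Hom(A, V)) a = l (x *> a).
Proof.
have l1 x : linear (fun a : A => l (x *> a)).
  by move=> k a b; rewrite ract_linr linearP.
pose F (x : X) : coinduced := linfun (fun a : A => l (x *> a)).
have FE x (a : A) : (F x : 'Hom(A, V)) a = l (x *> a) by rewrite linfunE.
have l2 : linear F.
  move=> k x y; apply/lfunP=> a; rewrite add_lfunE scale_lfunE !FE.
  by rewrite ract_linearl linearP.
exists (linfun F) => [x a|x a]; rewrite !linfunE //.
by apply/lfunP=> b; rewrite FE coinducedE FE ractM.
Qed.

Lemma injective_coinduced : rinjective coinduced.
Proof.
move=> X Y g f gh fh g0.
have l1 : linear (fun x : X => (f x : 'Hom(A, V)) 1).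
  by move=> k x y; rewrite linearP add_lfunE scale_lfunE.
pose l : 'Hom(X, V) := linfun (fun x : X => (f x : 'Hom(A, V)) 1).
have [l' lE] : exists l' : 'Hom(Y, V), l = (l' \o g)%VF.
  by apply: hom_extend; rewrite g0 sub0v.
have [F Fh FE] := rhom_coinduced l'; exists F => //.
apply/lfunP=> x; apply/lfunP=> a.
by rewrite comp_lfunE FE -gh -comp_lfunE -lE linfunE // fh coinducedE mulr1.
Qed.

End Coinduced.

End ProjectiveInjective.

(** * Duality *)

Definition dual_pairing (K : fieldType) (A A' : falgType K) (s : A -> A')
    (M : rmodule A) (L : rmodule A') (b : M -> L -> K^o) : Prop :=
  [/\ forall l, linear (b^~ l), forall m, linear (b m),
      forall m a l, b (m *> a) l = b m (l *> s a),
      forall m, (forall l, b m l = 0) -> m = 0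
    & forall l, (forall m, b m l = 0) -> l = 0].

Definition dual_of (K : fieldType) (A A' : falgType K) (s : A -> A')
    (M : rmodule A) (L : rmodule A') : Prop :=
  exists b, @dual_pairing K A A' s M L b.

(** Right modules over the opposite of the opposite algebra are not
    literally right A-modules. Duals are therefore given by perfect pairings, a
    notion that is symmetric in A and A': each fact about duals can be applied
    in both directions. That s is anti-multiplicative follows from the existence
    of enough pairings. *)
Definition duality (K : fieldType) (A A' : falgType K) (s : A -> A') (t : A' -> A) :=
  [/\ cancel s t, cancel t s, forall M, exists L, dual_of s M L
    & forall L, exists M, dual_of s M L].

Definition adjoint (K : fieldType) (A A' : falgType K) (M N : rmodule A)
    (L O : rmodule A') (b : M -> L -> K^o) (c : N -> O -> K^o)
    (f : 'Hom(M, N)) (f' : 'Hom(O, L)) :=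
  forall m o, c (f m) o = b m (f' o).

Section Pairing.
Variables (K : fieldType) (A A' : falgType K) (s : A -> A') (t : A' -> A).
Hypothesis ts : cancel t s.
Implicit Types (M N P : rmodule A) (L O : rmodule A').

Lemma dual_pairing_flip M L (b : M -> L -> K^o) :
  dual_pairing s b -> dual_pairing t (fun l m => b m l).
Proof. by case=> *; split=> // l a m; rewrite -{1}(ts a). Qed.

Lemma adjoint_flip M N L O (b : M -> L -> K^o) (c : N -> O -> K^o) f f' :
  adjoint b c f f' -> adjoint (fun l m => c m l) (fun l m => b m l) f' f.
Proof. by move=> h m o. Qed.

Lemma dual_pairing_dim M L (b : M -> L -> K^o) : dual_pairing s b ->
  (\dim {:L} <= \dim {:M})%N.
Proof.
case=> bl br bs b1 b2.
pose F (l : L) : 'Hom(M, K^o) := linfun (b^~ l).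
have FE l m : F l m = b m l by rewrite linfunE.
have Fl : linear F.
  by move=> k x y; apply/lfunP=> m; rewrite add_lfunE scale_lfunE !FE br.
have F0 : lker (linfun F) = 0%VS.
  apply: inj_lker0 => l; rewrite linfunE // => Fl0; apply: b2 => m.
  by rewrite -FE Fl0 zero_lfunE.
have := @limg_ker_dim _ _ _ (linfun F) fullv.
rewrite F0 capv0 dimv0 add0n => <-; apply: leq_trans (dimvS (subvf _)) _.
by rewrite !dimvf; apply: eq_leq; apply: muln1.
Qed.

End Pairing.

Section Adjoints.
Variables (K : fieldType) (A A' : falgType K) (s : A -> A') (t : A' -> A).
Hypothesis ts : cancel t s.
Implicit Types (M N P X : rmodule A) (L O Q Z : rmodule A').

(** Each side embeds into the dual of the other, so both embeddings are
    isomorphisms by dimension. *)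
Lemma dual_represent M L (b : M -> L -> K^o) (phi : 'Hom(M, K^o)) :
  dual_pairing s b -> exists l, forall m, phi m = b m l.
Proof.
move=> bP; have d := dual_pairing_dim (dual_pairing_flip ts bP).
case: bP => bl br bs b1 b2.
pose F (l : L) : 'Hom(M, K^o) := linfun (b^~ l).
have FE l m : F l m = b m l by rewrite linfunE.
have Fl : linear F.
  by move=> k x y; apply/lfunP=> m; rewrite add_lfunE scale_lfunE !FE br.
have F0 : lker (linfun F) = 0%VS.
  apply: inj_lker0 => l; rewrite linfunE // => Fl0; apply: b2 => m.
  by rewrite -FE Fl0 zero_lfunE.
have F1 : limg (linfun F) = fullv.
  apply/eqP; rewrite eqEdim subvf /=.
  have := @limg_ker_dim _ _ _ (linfun F) fullv.
  rewrite F0 capv0 dimv0 add0n => ->; apply: leq_trans d.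
  by rewrite !dimvf; apply: eq_leq; apply: muln1.
have [l lE] := (limg_fullP _).1 F1 phi; exists l => m.
by rewrite -lE linfunE // FE.
Qed.

Lemma adjoint_exists M N L O (b : M -> L -> K^o) (c : N -> O -> K^o)
    (f : 'Hom(M, N)) :
    dual_pairing s b -> dual_pairing s c -> is_rhom f ->
  exists2 f' : 'Hom(O, L), is_rhom f' & adjoint b c f f'.
Proof.
move=> bP cP fh; have [bl br bs b1 b2] := bP; have [cl cr cs c1 c2] := cP.
pose R o l := forall m, c (f m) o = b m l.
have cr0 m : c m 0 = 0.
  by have := cr m (-1) 0 0; rewrite scaler0 addr0 scaleN1r addNr.
have br0 m : b m 0 = 0.
  by have := br m (-1) 0 0; rewrite scaler0 addr0 scaleN1r addNr.
have [||||f' f'h f'P] := @rhom_of_rel _ _ O L R.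
- move=> o.
  have ll : linear (fun m : M => c (f m) o) by move=> k x y; rewrite linearP cl.
  have [l lE] := dual_represent (linfun (fun m : M => c (f m) o)) bP.
  by exists l => m; rewrite -lE linfunE.
- by move=> l Rl; apply: b2 => m; rewrite -Rl cr0.
- by move=> k u v u' v' h h' m; rewrite br cr h h'.
- by move=> u v a h m; rewrite -(ts a) -bs -cs -fh h.
by exists f' => // m o; apply: f'P.
Qed.

Lemma adjoint_unique M N L O (b : M -> L -> K^o) (c : N -> O -> K^o)
    (f : 'Hom(M, N)) (f1 f2 : 'Hom(O, L)) :
    dual_pairing s b -> adjoint b c f f1 -> adjoint b c f f2 -> f1 = f2.
Proof.
move=> [bl br bs b1 b2] h1 h2; apply/lfunP=> o; apply/eqP; rewrite -subr_eq0.
apply/eqP/b2 => m; rewrite addrC -scaleN1r br -h1 -h2.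
by rewrite scaleN1r addNr.
Qed.

Lemma adjoint_comp M1 M2 M3 L1 L2 L3 (b1 : M1 -> L1 -> K^o) (b2 : M2 -> L2 -> K^o)
    (b3 : M3 -> L3 -> K^o) (f : 'Hom(M1, M2)) (g : 'Hom(M2, M3))
    (f' : 'Hom(L2, L1)) (g' : 'Hom(L3, L2)) :
    adjoint b1 b2 f f' -> adjoint b2 b3 g g' ->
  adjoint b1 b3 (g \o f)%VF (f' \o g')%VF.
Proof. by move=> h1 h2 m o; rewrite !comp_lfunE h2 h1. Qed.

Lemma adjoint_id M L (b : M -> L -> K^o) : adjoint b b \1%VF \1%VF.
Proof. by move=> m o; rewrite !id_lfunE. Qed.

Lemma pairing0r M L (b : M -> L -> K^o) m : dual_pairing s b -> b m 0 = 0.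
Proof.
by case=> _ br _ _ _; have := br m (-1) 0 0; rewrite scaler0 addr0 scaleN1r addNr.
Qed.

(** Duality exchanges images and kernels and reverses inclusions. Minimality
    conditions, once expressed by such inclusions, can be dualized with it. *)
Lemma adjoint_limg M1 M2 N L1 L2 O (b1 : M1 -> L1 -> K^o) (b2 : M2 -> L2 -> K^o)
    (c : N -> O -> K^o) (u : 'Hom(M1, N)) (v : 'Hom(M2, N))
    (u' : 'Hom(O, L1)) (v' : 'Hom(O, L2)) :
    dual_pairing s b1 -> dual_pairing s b2 -> dual_pairing s c ->
    adjoint b1 c u u' -> adjoint b2 c v v' ->
  (limg u <= limg v)%VS <-> (lker v' <= lker u')%VS.
Proof.
move=> b1P b2P cP uu' vv'; have [_ _ _ _ b1n] := b1P; have [_ _ _ _ b2n] := b2P.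
split=> /subvP le; apply/subvP=> x.
  rewrite !memv_ker => /eqP vx; apply/eqP/b1n => m.
  rewrite -uu'; have /le/mem_limg[y <-] : u m \in limg u by apply/mem_limg; exists m.
  by rewrite vv' vx (pairing0r _ b2P).
move=> /mem_limg[m <-]; apply: separate => phi phi0.
have [o oE] := dual_represent phi cP.
have /le : o \in lker v'.
  rewrite memv_ker; apply/eqP/b2n => y; rewrite -vv' -oE; apply: phi0.
  by apply/mem_limg; exists y.
by rewrite memv_ker oE uu' => /eqP->; rewrite (pairing0r _ b1P).
Qed.

Lemma adjoint_exact M1 M2 M3 L1 L2 L3 (b1 : M1 -> L1 -> K^o) (b2 : M2 -> L2 -> K^o)
    (b3 : M3 -> L3 -> K^o) (f : 'Hom(M1, M2)) (g : 'Hom(M2, M3))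
    (f' : 'Hom(L2, L1)) (g' : 'Hom(L3, L2)) :
    dual_pairing s b1 -> dual_pairing s b2 -> dual_pairing s b3 ->
    adjoint b1 b2 f f' -> adjoint b2 b3 g g' -> limg f = lker g ->
  limg g' = lker f'.
Proof.
move=> b1P b2P b3P ff' gg' fg.
have [_ _ _ _ b1n] := b1P; have [b2l b2r _ _ b2n] := b2P.
have [b3l _ _ _ _] := b3P.
apply/vspaceP=> l; apply/idP/idP.
  move=> /mem_limg[o <-]; rewrite memv_ker; apply/eqP/b1n => m.
  rewrite -ff' -gg'; have /eqP-> : g (f m) == 0.
    by rewrite -memv_ker -fg; apply/mem_limg; exists m.
  by have := b3l o (-1) 0 0; rewrite scaler0 addr0 scaleN1r addNr.
rewrite memv_ker => /eqP f'l.
have le : (lker g <= lker (linfun (b2^~ l)))%VS.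
  apply/subvP=> x; rewrite -fg => /mem_limg[m <-].
  by rewrite memv_ker linfunE // ff' f'l (pairing0r _ b1P).
have [psi psiE] := hom_extend le; have [o oE] := dual_represent psi b3P.
apply/mem_limg; exists o; apply/eqP; rewrite -subr_eq0; apply/eqP/b2n => m.
rewrite addrC -scaleN1r b2r -gg' -oE -comp_lfunE -psiE linfunE //.
by rewrite scaleN1r addNr.
Qed.

Lemma adjoint_full M N L O (b : M -> L -> K^o) (c : N -> O -> K^o)
    (f : 'Hom(M, N)) (f' : 'Hom(O, L)) :
    dual_pairing s b -> dual_pairing s c -> adjoint b c f f' ->
  limg f = fullv <-> lker f' = 0%VS.
Proof.
move=> bP cP ff'; have aid := @adjoint_id N O c.
have := adjoint_limg cP bP cP aid ff'.
have -> : limg (\1%VF : 'End(N)) = fullv.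
  by apply/limg_fullP => v; exists v; rewrite id_lfunE.
have -> : lker (\1%VF : 'End(O)) = 0%VS.
  by apply: inj_lker0 => v; rewrite id_lfunE.
move=> [h1 h2]; split=> [f1 | f0].
  by apply/eqP; rewrite -subv0; apply: h1; rewrite f1 subvv.
by apply/eqP; rewrite eqEsubv subvf; apply: h2; rewrite f0 subvv.
Qed.

End Adjoints.

(** * Minimality in terms of maps *)

Section Minimality.
Variables (K : fieldType) (A : falgType K).
Implicit Types I M N P Q X Y Z : rmodule A.

(** A linear map with kernel U gives a homomorphism into a coinduced module,
    the kernel of which consists of the x with x A inside U, hence is U. This
    replaces quotient modules. *)
Lemma submodule_kernel X (U : {vspace X}) : submodule U ->
  exists Y (h : 'Hom(X, Y)), [/\ rinjective Y, is_rhom h & lker h = U].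
Proof.
move=> subU; have [F Fh FE] := @rhom_coinduced K A X X (\1 - projv U)%VF.
exists (coinduced A X), F; split=> //; first exact: injective_coinduced.
have lE x : ((\1 - projv U)%VF x == 0) = (x \in U).
  rewrite add_lfunE opp_lfunE id_lfunE subr_eq0.
  by apply/eqP/idP=> [-> | /projv_id->//]; apply: memv_proj.
apply/vspaceP=> x; rewrite memv_ker; apply/eqP/idP=> [Fx | xU].
  by rewrite -lE -[x]ract1 -FE Fx zero_lfunE.
by apply/lfunP=> a; rewrite FE zero_lfunE; apply/eqP; rewrite lE subU.
Qed.

(** This condition and the one of essentialP are dual to each other term by
    term, unlike the definitions, which speak of sums and of intersections. *)
Lemma superfluousP P Z (f : 'Hom(P, Z)) : is_rhom f ->
  superfluous (lker f) <->
  forall X (h : 'Hom(X, P)), is_rhom h -> (limg f <= limg (f \o h))%VS ->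
    limg h = fullv.
Proof.
move=> fh; split=> [sup X h hh /subvP le | sup V subV fV].
  apply: sup; first exact: submodule_limg.
  apply/vspaceP=> x; rewrite memvf.
  have /le/mem_limg[y] : f x \in limg f by apply/mem_limg; exists x.
  rewrite comp_lfunE => fy; rewrite -[x](subrK (h y)); apply: memv_add.
    by rewrite memv_ker linearB /= fy subrr.
  by apply/mem_limg; exists y.
have [Y [i [ih i0 iV]]] := submodule_embedding subV.
rewrite -iV; apply: sup => //; apply/subvP=> _ /mem_limg[x <-].
have : x \in (lker f + V)%VS by rewrite fV memvf.
move=> /memv_addP[u uf [v]]; rewrite -iV => /mem_limg[y <-] ->.
apply/mem_limg; exists y; rewrite comp_lfunE linearD /=.
by move: uf; rewrite memv_ker => /eqP->; rewrite add0r.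
Qed.

Lemma essentialP I Z (g : 'Hom(Z, I)) : is_rhom g ->
  essential (limg g) <->
  forall X (h : 'Hom(I, X)), is_rhom h -> (lker (h \o g) <= lker g)%VS ->
    lker h = 0%VS.
Proof.
move=> gh; split=> [ess X h hh /subvP le | ess V subV gV].
  apply: ess; first exact: submodule_lker.
  apply/eqP; rewrite -subv0; apply/subvP=> x.
  rewrite memv_cap => /andP[/mem_limg[z <-] hz]; rewrite memv0 -memv_ker.
  by apply: le; move: hz; rewrite !memv_ker comp_lfunE.
have [Y [h [_ hh hV]]] := submodule_kernel subV.
rewrite -hV; apply: ess => //; apply/subvP=> z.
rewrite memv_ker comp_lfunE -memv_ker hV => zV.
rewrite memv_ker -memv0 -gV memv_cap zV andbT.
by apply/mem_limg; exists z.
Qed.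

End Minimality.

Section Isomorphisms.
Variables (K : fieldType) (A : falgType K).
Implicit Types M N X : rmodule A.

Lemma rmod_isoP M N : rmod_iso M N <->
  exists (f : 'Hom(M, N)) (g : 'Hom(N, M)),
    [/\ is_rhom f, is_rhom g, forall x, g (f x) = x & forall y, f (g y) = y].
Proof.
split=> [[f [fh f0 f1]] | [f [g [fh gh fK gK]]]].
  exists f, (f^-1)%VF; split=> //; first exact: rhom_inv.
    by apply: lker0_lfunK; rewrite f0.
  by move=> y; rewrite limg_lfunVK ?f1 ?memvf.
exists f; split=> //.
  by apply: inj_lker0 => x fx; rewrite -[x]fK fx linear0.
by apply/limg_fullP => y; exists (g y).
Qed.

Lemma rmod_iso_refl M : rmod_iso M M.
Proof.
by apply/rmod_isoP; exists \1%VF, \1%VF; split=> [||x|x]; rewrite ?id_lfunE //; apply: rhom_id.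
Qed.

Lemma rmod_iso_sym M N : rmod_iso M N -> rmod_iso N M.
Proof.
by move=> /rmod_isoP[f [g [fh gh fK gK]]]; apply/rmod_isoP; exists g, f.
Qed.

End Isomorphisms.

Section DualObjects.
Variables (K : fieldType) (A A' : falgType K) (s : A -> A') (t : A' -> A).
Implicit Types (M N P : rmodule A) (L O : rmodule A').

Lemma duality_sym : duality s t -> duality t s.
Proof.
move=> [st ts dl dr]; split=> // [L | M].
  by have [M [b bP]] := dr L; exists M, (fun l m => b m l); apply: dual_pairing_flip bP.
by have [L [b bP]] := dl M; exists L, (fun l m => b m l); apply: dual_pairing_flip bP.
Qed.

Lemma dual_of_flip M L : duality s t -> dual_of s M L -> dual_of t L M.
Proof.
move=> [st ts _ _] [b bP]; exists (fun l m => b m l).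
exact: dual_pairing_flip bP.
Qed.

Lemma dual_of_iso M N L : dual_of s M L -> rmod_iso M N -> dual_of s N L.
Proof.
move=> [b [bl br bs b1 b2]] /rmod_isoP[f [g [fh gh fK gK]]].
exists (fun n l => b (g n) l); split=> //.
- by move=> l k x y; rewrite linearP bl.
- by move=> m a l; rewrite gh bs.
- by move=> m h; rewrite -[m]gK (b1 _ h) linear0.
- by move=> l h; apply: b2 => m; rewrite -[m]fK.
Qed.

Lemma dual_of_iso_right M N L O :
  duality s t -> dual_of s M L -> dual_of s N O -> rmod_iso M N -> rmod_iso O L.
Proof.
move=> [st ts _ _] [b bP] [c cP] /rmod_isoP[f [g [fh gh fK gK]]].
have [f' f'h ff'] := adjoint_exists ts bP cP fh.
have [g' g'h gg'] := adjoint_exists ts cP bP gh.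
have gf : (g \o f)%VF = \1%VF by apply/lfunP=> x; rewrite comp_lfunE id_lfunE fK.
have fg : (f \o g)%VF = \1%VF by apply/lfunP=> x; rewrite comp_lfunE id_lfunE gK.
have a1 := adjoint_comp ff' gg'; have a2 := adjoint_comp gg' ff'.
rewrite gf in a1; rewrite fg in a2.
have e1 := adjoint_unique bP a1 (adjoint_id b).
have e2 := adjoint_unique cP a2 (adjoint_id c).
apply/rmod_isoP; exists f', g'; split=> // x; rewrite -comp_lfunE ?e1 ?e2 id_lfunE //.
Qed.

Lemma dual_of_unique M L O :
  duality s t -> dual_of s M L -> dual_of s M O -> rmod_iso L O.
Proof. by move=> D dL dO; apply: dual_of_iso_right D dO dL (rmod_iso_refl M). Qed.

Lemma injective_dual (P : rmodule A) (I : rmodule A') :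
  duality s t -> dual_of s P I -> rprojective P -> rinjective I.
Proof.
move=> D [b bP] projP X Y g f gh fh g0; have [st ts _ dr] := D.
have [X' [x xP]] := dr X; have [Y' [y yP]] := dr Y.
have xP' := dual_pairing_flip ts xP; have yP' := dual_pairing_flip ts yP.
have bP' := dual_pairing_flip ts bP.
have [g' g'h gg'] := adjoint_exists st xP' yP' gh.
have [f' f'h ff'] := adjoint_exists st xP' bP' fh.
have g'1 : limg g' = fullv by apply/(adjoint_full ts yP xP (adjoint_flip gg')).
have [h hh hE] := projP _ _ _ _ g'h f'h g'1.
have [h' h'h hh'] := adjoint_exists ts bP yP hh.
exists h' => //; apply: (adjoint_unique bP) (adjoint_flip ff').
by rewrite -hE; apply: adjoint_comp hh' (adjoint_flip gg').
Qed.

Lemma projective_dual (I : rmodule A) (P : rmodule A') :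
  duality s t -> dual_of s I P -> rinjective I -> rprojective P.
Proof.
move=> D [b bP] injI X Y g f gh fh g1; have [st ts _ dr] := D.
have [X' [x xP]] := dr X; have [Y' [y yP]] := dr Y.
have xP' := dual_pairing_flip ts xP; have yP' := dual_pairing_flip ts yP.
have bP' := dual_pairing_flip ts bP.
have [g' g'h gg'] := adjoint_exists st xP' yP' gh.
have [f' f'h ff'] := adjoint_exists st bP' yP' fh.
have g'0 : lker g' = 0%VS by apply/(adjoint_full st xP' yP' gg').
have [h hh hE] := injI _ _ _ _ g'h f'h g'0.
have [h' h'h hh'] := adjoint_exists ts xP bP hh.
exists h' => //; apply: (adjoint_unique yP) (adjoint_flip ff').
by rewrite -hE; apply: adjoint_comp (adjoint_flip gg') hh'.
Qed.

(** An adjoint of h tests the dual condition, by adjoint_limg. *)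
Lemma superfluous_dual M N L O (b : M -> L -> K^o) (c : N -> O -> K^o)
    (f : 'Hom(M, N)) (f' : 'Hom(O, L)) :
    duality s t -> dual_pairing s b -> dual_pairing s c ->
    is_rhom f -> is_rhom f' -> adjoint b c f f' ->
  superfluous (lker f) <-> essential (limg f').
Proof.
move=> D bP cP fh f'h ff'; have [st ts dl dr] := D.
have bP' := dual_pairing_flip ts bP.
rewrite superfluousP // essentialP //; split=> min X h hh le.
  have [X' [x xP]] := dr X; have xP' := dual_pairing_flip ts xP.
  have [h' h'h hh'] := adjoint_exists st bP' xP' hh.
  have ca := adjoint_comp (adjoint_flip hh') ff'.
  apply/(adjoint_full ts xP bP (adjoint_flip hh'))/min => //.
  exact/(adjoint_limg ts bP xP cP ff' ca).
have [X' [x xP]] := dl X; have xP' := dual_pairing_flip ts xP.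
have [h' h'h hh'] := adjoint_exists ts xP bP hh.
apply/(adjoint_full ts xP bP hh')/min => //.
exact/(adjoint_limg ts bP xP cP ff' (adjoint_comp hh' ff')).
Qed.

End DualObjects.

Section DualResolutions.
Variables (K : fieldType) (A A' : falgType K) (s : A -> A') (t : A' -> A).
Implicit Types (M N P : rmodule A) (L O : rmodule A').

Lemma projective_cover_dual M P L (I : rmodule A') (b : M -> L -> K^o) (c : P -> I -> K^o)
    (p : 'Hom(P, M)) (i : 'Hom(L, I)) :
    duality s t -> dual_pairing s b -> dual_pairing s c ->
    is_rhom i -> adjoint c b p i ->
  projective_cover p -> injective_hull i.
Proof.
move=> D bP cP ih pi [projP ph p1 sup]; have [st ts _ _] := D; split=> //.
- by apply: (injective_dual D) projP; exists c.
- exact/(adjoint_full ts cP bP pi).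
- exact/(superfluous_dual D cP bP ph ih pi).
Qed.

Lemma injective_hull_dual M (I : rmodule A) L (P : rmodule A')
    (b : M -> L -> K^o) (c : I -> P -> K^o)
    (i : 'Hom(M, I)) (p : 'Hom(P, L)) :
    duality s t -> dual_pairing s b -> dual_pairing s c ->
    is_rhom p -> adjoint b c i p ->
  injective_hull i -> projective_cover p.
Proof.
move=> D bP cP ph ip [injI ih i0 ess]; have [st ts _ _] := D.
have bP' := dual_pairing_flip ts bP; have cP' := dual_pairing_flip ts cP.
split=> //.
- by apply: (projective_dual D) injI; exists c.
- exact/(adjoint_full st cP' bP' (adjoint_flip ip)).
- exact/(superfluous_dual (duality_sym D) cP' bP' ph ih (adjoint_flip ip)).
Qed.

Lemma cosyzygy_dual n M (X : rmodule A) L O :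
    duality s t -> dual_of s M L -> dual_of s X O ->
  is_syzygy n M X -> is_cosyzygy n L O.
Proof.
move=> D dM; have [st ts dl dr] := D.
elim: n X O => [|n IH] X O dX /=.
  by move=> iso; apply: rmod_iso_sym; apply: (dual_of_iso_right D dM dX iso).
move=> [Y syz [P [p [i [cover ih i0 ip]]]]].
have [Y' [y yP]] := dl Y; have [P' [c cP]] := dl P; have [x xP] := dX.
exists Y'; first by apply: IH syz; exists y.
have [projP ph p1 _] := cover.
have [p' p'h pp'] := adjoint_exists ts cP yP ph.
have [i' i'h ii'] := adjoint_exists ts xP cP ih.
exists P', p', i'; split=> //.
- exact: projective_cover_dual D yP cP p'h pp' cover.
- exact/(adjoint_full st (dual_pairing_flip ts cP) (dual_pairing_flip ts xP)
           (adjoint_flip ii')).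
- exact/esym/(adjoint_exact ts xP cP yP ii' pp' ip).
Qed.

Lemma syzygy_dual n M (X : rmodule A) L O :
    duality s t -> dual_of s M L -> dual_of s X O ->
  is_cosyzygy n M X -> is_syzygy n L O.
Proof.
move=> D dM; have [st ts dl dr] := D.
elim: n X O => [|n IH] X O dX /=.
  by move=> iso; apply: rmod_iso_sym; apply: (dual_of_iso_right D dM dX iso).
move=> [Y syz [I [i [q [hull qh q1 qi]]]]].
have [Y' [y yP]] := dl Y; have [I' [c cP]] := dl I; have [x xP] := dX.
exists Y'; first by apply: IH syz; exists y.
have [injI ih i0 _] := hull.
have [i' i'h ii'] := adjoint_exists ts yP cP ih.
have [q' q'h qq'] := adjoint_exists ts cP xP qh.
exists I', i', q'; split=> //.
- exact: injective_hull_dual D yP cP i'h ii' hull.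
- exact/(adjoint_full ts cP xP qq').
- exact: (adjoint_exact ts yP cP xP ii' qq' (esym qi)).
Qed.

End DualResolutions.

Section Presentations.
Variables (K : fieldType) (A : falgType K).

Definition minimal_presentation (M P0 P1 : rmodule A) (p : 'Hom(P0, M))
    (f : 'Hom(P1, P0)) : Prop :=
  projective_cover p /\
  [/\ rprojective P1, is_rhom f, limg f = lker p & superfluous (lker f)].

Definition minimal_copresentation (M I0 I1 : rmodule A) (i : 'Hom(M, I0))
    (g : 'Hom(I0, I1)) : Prop :=
  injective_hull i /\
  [/\ rinjective I1, is_rhom g, limg i = lker g & essential (limg g)].

Definition proj_inj_presented (M : rmodule A) : Prop :=
  exists (P0 P1 : rmodule A) (p : 'Hom(P0, M)) (f : 'Hom(P1, P0)),
    minimal_presentation p f /\ rinjective P0 /\ rinjective P1.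

Definition proj_inj_copresented (M : rmodule A) : Prop :=
  exists (I0 I1 : rmodule A) (i : 'Hom(M, I0)) (g : 'Hom(I0, I1)),
    minimal_copresentation i g /\ rprojective I0 /\ rprojective I1.

End Presentations.

Section DualPresentations.
Variables (K : fieldType) (A A' : falgType K) (s : A -> A') (t : A' -> A).

Lemma proj_inj_copresented_dual (M : rmodule A) (L : rmodule A') :
    duality s t -> dual_of s M L ->
  proj_inj_presented M -> proj_inj_copresented L.
Proof.
move=> D [b bP] [P0 [P1 [p [f [[cover [projP1 fh fp sup]] [inj0 inj1]]]]]].
have [st ts dl dr] := D; have [projP0 ph p1 _] := cover.
have [I0 [b0 b0P]] := dl P0; have [I1 [b1 b1P]] := dl P1.
have [i ih pi] := adjoint_exists ts b0P bP ph.
have [g gh fg] := adjoint_exists ts b1P b0P fh.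
exists I0, I1, i, g; split; last first.
  by split; apply: (projective_dual D); [exists b0 | | exists b1 |].
split; first exact: projective_cover_dual D bP b0P ih pi cover.
split=> //.
- by apply: (injective_dual D) projP1; exists b1.
- exact: (adjoint_exact ts b1P b0P bP fg pi fp).
- exact/(superfluous_dual D b1P b0P fh gh fg).
Qed.

Lemma proj_inj_presented_dual (M : rmodule A) (L : rmodule A') :
    duality s t -> dual_of s M L ->
  proj_inj_copresented M -> proj_inj_presented L.
Proof.
move=> D [b bP] [I0 [I1 [i [g [[hull [injI1 gh ig ess]] [proj0 proj1]]]]]].
have [st ts dl dr] := D; have [injI0 ih i0 _] := hull.
have [P0 [b0 b0P]] := dl I0; have [P1 [b1 b1P]] := dl I1.
have [p ph ip] := adjoint_exists ts bP b0P ih.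
have [f fh gf] := adjoint_exists ts b0P b1P gh.
have b0P' := dual_pairing_flip ts b0P; have b1P' := dual_pairing_flip ts b1P.
exists P0, P1, p, f; split; last first.
  by split; apply: (injective_dual D); [exists b0 | | exists b1 |].
split; first exact: injective_hull_dual D bP b0P ph ip hull.
split=> //.
- by apply: (projective_dual D) injI1; exists b1.
- exact: (adjoint_exact ts bP b0P b1P ip gf ig).
- exact/(superfluous_dual (duality_sym D) b1P' b0P' fh gh (adjoint_flip gf)).
Qed.

End DualPresentations.

Section OppositeDuality.
Variables (K : fieldType) (A : falgType K).

Lemma rdual_pairing (M : rmodule A) :
  dual_pairing (id : A -> A^c) (fun m (phi : rdual M) => (phi : 'Hom(M, K^o)) m).
Proof.
split.
- by move=> l k x y; rewrite linearP.
- by move=> m k x y; rewrite add_lfunE scale_lfunE.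
- by move=> m a l; rewrite comp_lfunE ractoE.
- exact: separate0.
- by move=> l h; apply/lfunP=> m; rewrite h zero_lfunE.
Qed.

Lemma dual_of_rdual (M : rmodule A) : dual_of (id : A -> A^c) M (rdual M).
Proof. by eexists; apply: rdual_pairing. Qed.

Lemma bidual_evaluation (M : rmodule A) (F : 'Hom('Hom(M, K^o), K^o)) :
  exists m, forall phi : 'Hom(M, K^o), F phi = phi m.
Proof.
exact: (@dual_represent K A^c A (id : A^c -> A) (id : A -> A^c) _ (rdual M) M _ F
  (@dual_pairing_flip K A A^c id id _ _ _ _ (rdual_pairing M))).
Qed.

Lemma dual_of_opop_rdual (L : rmodule A^c) :
  dual_of (id : A^c -> A) L (of_opop (rdual L)).
Proof.
exists (fun m (phi : of_opop (rdual L)) => (phi : 'Hom(L, K^o)) m); split.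
- by move=> l k x y; rewrite linearP.
- by move=> m k x y; rewrite add_lfunE scale_lfunE.
- by move=> m a l; rewrite comp_lfunE ractoE.
- exact: separate0.
- by move=> l h; apply/lfunP=> m; rewrite h zero_lfunE.
Qed.

Lemma duality_op : duality (id : A -> A^c) (id : A^c -> A).
Proof.
split=> // [M | L]; first by exists (rdual M); apply: dual_of_rdual.
have [b bP] := dual_of_opop_rdual L.
by exists (of_opop (rdual L)), (fun m l => b l m); apply: dual_pairing_flip bP.
Qed.

End OppositeDuality.

(** * Existence of minimal injective coresolutions *)

Lemma exists_minimizer (T : Type) (P : T -> Prop) (m : T -> nat) :
  (exists x, P x) -> exists2 x, P x & forall y, P y -> (m x <= m y)%N.
Proof.
move=> [x Px]; elim: {x}(m x).+1 {-2}x (ltnSn (m x)) Px => // n IH x mx Px.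
have [[y Py ly] | no] := classic (exists2 y, P y & (m y < m x)%N).
  by apply: IH Py; apply: leq_trans ly mx.
exists x => // y Py; rewrite leqNgt; apply/negP=> lt.
by apply: no; exists y.
Qed.

Lemma dim_limg_le (K : fieldType) (U V : vectType K) (f : 'Hom(U, V)) (W : {vspace U}) :
  (\dim (f @: W) <= \dim W)%N.
Proof. by rewrite -(limg_ker_dim f W) leq_addl. Qed.

Section Hulls.
Variables (K : fieldType) (A : falgType K).
Implicit Types I M N P Q X Y Z : rmodule A.

(** The Fitting decomposition: w is bijective on its image, which is therefore
    complementary to its kernel, and e is the projection onto the image. That e
    factors through w will carry factorizations of w over to e. *)
Lemma fitting_idempotent X (w : 'End(X)) :
    is_rhom w -> (limg w <= limg (w \o w))%VS ->
  exists e t : 'End(X), [/\ is_rhom e, is_rhom t, limg e = limg w,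
    forall x, e (w x) = w x & forall x, w (t x) = e x].
Proof.
move=> wh ww.
have cap0 : (limg w :&: lker w)%VS = 0%VS.
  apply/eqP; rewrite -dimv_eq0 -(eqn_add2r (\dim (w @: limg w))) limg_ker_dim add0n.
  by rewrite eqn_leq dim_limg_le andbT dimvS // -limg_comp.
have inj z : z \in limg w -> w z = 0 -> z = 0.
  by move=> zw wz; apply/eqP; rewrite -memv0 -cap0 memv_cap zw memv_ker wz /=.
have lift x : x \in limg w -> exists z, z \in limg w /\ w z = x.
  move=> /(subvP ww)/mem_limg[y]; rewrite comp_lfunE => yx.
  by exists (w y); split=> //; apply/mem_limg; exists y.
have subw := submodule_limg wh.
have rel (u : 'End(X)) : is_rhom u -> (limg u <= limg w)%VS ->
    exists2 v : 'End(X), is_rhom v & forall x, v x \in limg w /\ w (v x) = u x.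
  move=> uh /subvP uw.
  apply: (@rhom_of_rel _ _ X X (fun x z => z \in limg w /\ w z = u x)).
  - by move=> x; apply/lift/uw/mem_limg; exists x.
  - by move=> v [vw]; rewrite linear0 => /(inj _ vw).
  - by move=> k x z x' z' [h1 h2] [h3 h4]; rewrite memvD ?memvZ // !linearP /= h2 h4.
  - by move=> x z a [h1 h2]; rewrite subw // wh uh h2.
have [e eh eP] := rel w wh (subvv _).
have eW x : x \in limg w -> e x = x.
  move=> xw; apply/eqP; rewrite -subr_eq0; apply/eqP/inj.
    by rewrite memvB // (eP x).1.
  by rewrite linearB /= (eP x).2 subrr.
have e1 : limg e = limg w.
  apply/vspaceP=> x; apply/idP/idP=> [/mem_limg[y <-] | xw]; first exact: (eP y).1.
  by apply/mem_limg; exists x; apply: eW.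
have [|t th tP] := rel e eh; first by rewrite e1 subvv.
exists e, t; split=> // x; last exact: (tP x).2.
by apply: eW; apply/mem_limg; exists x.
Qed.

(** The injective hull of X / U. Among the endomorphisms of an injective
    module fixing a copy of X / U, one of minimal rank is, up to the Fitting
    lemma, idempotent; its image is injective, and is an essential extension
    because a smaller retract would lower the rank. *)
Lemma hull_of_quotient X (U : {vspace X}) : submodule U ->
  exists I (g : 'Hom(X, I)),
    [/\ rinjective I, is_rhom g, lker g = U & essential (limg g)].
Proof.
move=> subU; have [I0 [i [injI0 ih iU]]] := submodule_kernel subU.
pose fixing (w : 'End(I0)) := is_rhom w /\ (w \o i)%VF = i.
have [|w [wh wi] wmin] := @exists_minimizer _ fixing (fun w => \dim (limg w)).
  by exists \1%VF; split; [apply: rhom_id | rewrite comp_lfun1l].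
have ww : (limg w <= limg (w \o w))%VS.
  rewrite -(geq_leqif (dimv_leqif_sup _)); last by rewrite limg_comp limgS ?subvf.
  by apply: wmin; split; [apply: rhom_comp | rewrite -comp_lfunA !wi].
have [e [t [eh th ew eid wt]]] := fitting_idempotent wh ww.
have [J [j [jh j0 jI]]] := submodule_embedding (submodule_limg eh).
have [r rh rj] : exists2 r : 'Hom(I0, J), is_rhom r & (j \o r)%VF = e.
  by apply: rhom_factor_inj; rewrite ?jI ?subvv.
have iw x : i x = w (i x) by rewrite -comp_lfunE wi.
have [g gh gi] : exists2 g : 'Hom(X, J), is_rhom g & (j \o g)%VF = i.
  apply: rhom_factor_inj => //; rewrite jI ew; apply/subvP=> _ /mem_limg[x <-].
  by apply/mem_limg; exists (i x); rewrite -iw.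
have jinj x y : j x = j y -> x = y.
  by apply/lker0P; rewrite j0.
have rjE x : r (j x) = x.
  apply: jinj; rewrite -comp_lfunE rj.
  have /mem_limg[y <-] : j x \in limg w by rewrite -ew -jI; apply/mem_limg; exists x.
  exact: eid.
have injJ : rinjective J by apply: (injective_summand jh rh rjE).
have gU : lker g = U.
  apply/vspaceP=> x; rewrite -iU !memv_ker -gi comp_lfunE.
  by apply/eqP/eqP=> [-> | gx]; [rewrite linear0 | apply: lker0_inj gx].
exists J, g; split=> //; apply/essentialP => // Z h hh hg.
have hgh := rhom_comp gh hh.
have [E [m [mh m0 mE]]] := submodule_embedding (submodule_limg hgh).
have [q qh mq] : exists2 q : 'Hom(X, E), is_rhom q & (m \o q)%VF = (h \o g)%VF.
  by apply: rhom_factor_inj; rewrite ?mE ?subvv.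
have q1 : limg q = fullv.
  apply/limg_fullP => y.
  have : m y \in limg (h \o g) by rewrite -mE; apply/mem_limg; exists y.
  move=> /mem_limg[x xy]; exists x; apply/eqP; rewrite -subr_eq0; apply/eqP.
  by apply: (lker0_inj m0); rewrite linearB /= -comp_lfunE mq xy subrr.
have [g' g'h g'q] : exists2 g' : 'Hom(E, J), is_rhom g' & (g' \o q)%VF = g.
  apply: rhom_factor_surj => //; apply: subv_trans hg; rewrite -mq.
  by apply/subvP=> x; rewrite !memv_ker comp_lfunE => /eqP->; rewrite linear0.
have [k kh km] := injJ _ _ m g' mh g'h m0.
have khg x : k (h (g x)) = g x.
  rewrite -[h (g x)]comp_lfunE -mq -[RHS]/(g x) -g'q -km.
  by rewrite !comp_lfunE.
have rank_h : (\dim (limg e) <= \dim (limg h))%N.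
  rewrite ew; apply: leq_trans (wmin ((j \o k) \o (h \o r))%VF _) _.
    split; first by apply: rhom_comp; apply: rhom_comp.
    by apply/lfunP=> x; rewrite !comp_lfunE -gi !comp_lfunE rjE khg.
  rewrite limg_comp; apply: leq_trans (dim_limg_le _ _) (dimvS _).
  by rewrite limg_comp limgS ?subvf.
have dimJ : \dim (limg e) = \dim {:J}.
  by rewrite -jI limg_dim_eq // j0 capv0.
apply/eqP; rewrite -dimv_eq0 -leqn0 -(leq_add2r (\dim (limg h))).
by have := limg_ker_dim h fullv; rewrite capfv => ->; rewrite add0n -dimJ.
Qed.

(** A term of a coresolution with the image of the differential that enters it:
    all that the next term depends on. *)
Definition submod_state := {X : rmodule A & {U : {vspace X} | submodule U}}.

Definition hull_spec (st : submod_state)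
    (Ig : {I : rmodule A & 'Hom(projT1 st, I)}) : Prop :=
  [/\ rinjective (projT1 Ig), is_rhom (projT2 Ig),
      lker (projT2 Ig) = proj1_sig (projT2 st)
    & essential (limg (projT2 Ig))].

Lemma hull_spec_ex st : exists Ig, @hull_spec st Ig.
Proof.
case: st => X [U subU]; have [I [g gP]] := hull_of_quotient subU.
by exists (existT _ I g).
Qed.

Definition next_hull (st : submod_state) :=
  constructive_indefinite_description _ (hull_spec_ex st).

Definition next_module (st : submod_state) : rmodule A := projT1 (proj1_sig (next_hull st)).

Definition next_map (st : submod_state) : 'Hom(projT1 st, next_module st) :=
  projT2 (proj1_sig (next_hull st)).

Lemma next_mapP (st : submod_state) : [/\ rinjective (next_module st), is_rhom (next_map st),
  lker (next_map st) = proj1_sig (projT2 st) & essential (limg (next_map st))].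
Proof. exact: (proj2_sig (next_hull st)). Qed.

Lemma next_map_submodule (st : submod_state) : submodule (limg (next_map st)).
Proof. by apply: submodule_limg; case: (next_mapP st). Qed.

Definition next_state (st : submod_state) : submod_state :=
  existT _ (next_module st) (exist _ (limg (next_map st)) (@next_map_submodule st)).

(** Dominant dimension at least 2 concerns only the first two terms, but its
    definition speaks of a complete coresolution. *)
Lemma coresolution_extending M I0 I1 (i : 'Hom(M, I0)) (g : 'Hom(I0, I1)) :
    minimal_copresentation i g ->
  exists C : min_inj_coresolution M, coterm C 0 = I0 /\ coterm C 1 = I1.
Proof.
move=> [hull [injI1 gh ig ess]].
pose st0 : submod_state := existT _ I1 (exist _ (limg g) (submodule_limg gh)).
pose st n := iter n next_state st0.
pose cot n : rmodule A := if n is n'.+1 then projT1 (st n') else I0.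
pose cdiff n : 'Hom(cot n, cot n.+1) :=
  match n return 'Hom(cot n, cot n.+1) with
  | 0%N => g
  | n'.+1 => next_map (st n')
  end.
have inj n : rinjective (cot n).
  case: n => [|[|n]] //=; first by case: hull.
  by case: (next_mapP (st n)).
have hom n : is_rhom (cdiff n) by case: n => [|n] //=; case: (next_mapP (st n)).
have exact n : limg (cdiff n) = lker (cdiff n.+1).
  by case: n => [|n] /=; [case: (next_mapP (st 0%N)) | case: (next_mapP (st n.+1))].
have esse n : essential (limg (cdiff n)).
  by case: n => [|n] //=; case: (next_mapP (st n)).
by exists (@MinInjCoresolution K A M cot i cdiff hull inj hom ig exact esse).
Qed.

Lemma domdim_ge2P M : domdim_ge M 2 <-> proj_inj_copresented M.
Proof.
split=> [[d [C Cd] d2] | [I0 [I1 [i [g [min [proj0 proj1]]]]]]].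
  have proj n : (n < 2)%N -> rprojective (coterm C n).
    case: d Cd d2 => [d [_ Cd] d2 n2 | Cd _ _ //]; apply: Cd.
    exact: leq_trans n2 d2.
  exists (coterm C 0), (coterm C 1), (coaug C), (codiff C 0); split;
    last by split; apply: proj.
  split; first exact: coaug_hull.
  by split; [apply: coterm_inj | apply: codiff_hom | apply: coexact0 | apply: codiff_ess].
have [C [C0 C1]] := coresolution_extending min.
have [[n Cn] | all_proj] := classic (exists n, ~ rprojective (coterm C n)).
  have [|m Cm mmin] := @exists_minimizer _ (fun n => ~ rprojective (coterm C n)) id.
    by exists n.
  exists (Some m).
    exists C; split=> // k km; apply: NNPP => Ck.
    by have := mmin _ Ck; rewrite leqNgt km.
  by case: m Cm {mmin} => [|[|m]] //; rewrite ?C0 ?C1 => Cm; case: Cm.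
exists None => //; exists C => k; apply: NNPP => Ck; apply: all_proj.
by exists k.
Qed.

End Hulls.

(** * Modules copresented by powers of one injective module *)

Section Copresented.
Variables (K : fieldType) (A : falgType K) (Q : rmodule A).
Implicit Types P X Y : rmodule A.

Definition torsionless Y :=
  forall y, (forall h : 'Hom(Y, Q), is_rhom h -> h y = 0) -> y = 0.

(** Here z is an element of the double dual of Y with respect to Q, and
    End(Q) acts on Hom(Y, Q) from the left. Surjectivity of the evaluation of
    Y in its double dual passes to projective modules and to kernels without
    any choice of powers of Q; copresentation_of_reflexive turns it into an
    exact sequence. *)
Definition reflexive_wrt Y :=
  forall z : 'Hom(Y, Q) -> Q,
    (forall k h h', is_rhom h -> is_rhom h' -> z (k *: h + h') = k *: z h + z h') ->
    (forall (beta : 'End(Q)) h, is_rhom beta -> is_rhom h -> z (beta \o h)%VF = beta (z h)) ->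
  exists y, forall h, is_rhom h -> z h = h y.

Lemma linear_on_sum Y (z : 'Hom(Y, Q) -> Q) :
    (forall k h h', is_rhom h -> is_rhom h' -> z (k *: h + h') = k *: z h + z h') ->
  forall n (h : 'I_n -> 'Hom(Y, Q)), (forall i, is_rhom (h i)) ->
    z (\sum_i h i) = \sum_i z (h i).
Proof.
move=> zl n h hh.
have z0 : z 0 = 0.
  have := zl (-1) _ _ (@rhom0 _ _ Y Q) (@rhom0 _ _ Y Q).
  by rewrite scaler0 addr0 scaleN1r addNr.
have step h1 h2 : is_rhom h1 -> is_rhom h2 -> z (h1 + h2) = z h1 + z h2.
  by move=> h1h h2h; have := zl 1 _ _ h1h h2h; rewrite !scale1r.
elim: (index_enum _) => [|i r IH]; first by rewrite !big_nil.
by rewrite !big_cons step ?IH //; apply: rhom_sum.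
Qed.

Definition orbit_map (xi : Q) : 'Hom(rregular A, Q) :=
  linfun (fun a : rregular A => xi *> (a : A)).

Lemma orbit_mapE xi (a : A) : orbit_map xi a = xi *> a.
Proof. by rewrite linfunE // => k x y; apply: ract_linr. Qed.

Lemma rhom_orbit_map xi : is_rhom (orbit_map xi).
Proof. by move=> a b; rewrite !orbit_mapE -ractM. Qed.

Lemma rhom_regularE (h : 'Hom(rregular A, Q)) : is_rhom h -> h = orbit_map (h 1).
Proof. by move=> hh; apply/lfunP=> a; rewrite orbit_mapE -hh /= mul1r. Qed.

(** A projective module is reflexive because the regular module is: a dual
    basis writes every h : P -> Q as a sum of maps through the regular module. *)
Lemma reflexive_projective P :
  reflexive_wrt (rregular A) -> rprojective P -> reflexive_wrt P.
Proof.
move=> reflA projP z zl zb; have [n [x [g [gh gE]]]] := dual_basis projP.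
have /fin_all_exists[a aP] : forall i : 'I_n, exists a : A,
    forall h : 'Hom(rregular A, Q), is_rhom h -> z (h \o g i)%VF = h a.
  move=> i; apply: (reflA (fun h => z (h \o g i)%VF)).
    move=> k h h' hh h'h; rewrite comp_lfunDl -comp_lfunZl zl //; exact: rhom_comp.
  by move=> beta h bh hh; rewrite -comp_lfunA zb //; apply: rhom_comp.
exists (\sum_i x i *> a i) => h hh.
have hE : h = \sum_i (orbit_map (h (x i)) \o g i)%VF.
  apply/lfunP=> y; rewrite {1}(gE y) linear_sum sum_lfunE; apply: eq_bigr => i _ /=.
  by rewrite hh comp_lfunE orbit_mapE.
rewrite {1}hE linear_on_sum // => [|i]; last exact: rhom_comp (gh i) (rhom_orbit_map _).
rewrite linear_sum; apply: eq_bigr => i _ /=.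
by rewrite (aP i) ?hh ?orbit_mapE //; apply: rhom_orbit_map.
Qed.

Lemma torsionless_projective P :
  torsionless (rregular A) -> rprojective P -> torsionless P.
Proof.
move=> torA projP y hy; apply: projective_torsionless => // g gh; apply: torA => h hh.
by rewrite -comp_lfunE; apply/hy/rhom_comp.
Qed.

Lemma torsionless_sub X Y (i : 'Hom(Y, X)) :
  is_rhom i -> lker i = 0%VS -> torsionless X -> torsionless Y.
Proof.
move=> ih i0 torX y hy; apply: (lker0_inj i0); apply: torX => h hh.
by rewrite -comp_lfunE; apply/hy/rhom_comp.
Qed.

(** An element of the double dual of Y pushes forward to one of X, hence to an
    element x of X. As X' is torsionless, x lies in the kernel; as Q is
    injective, all of Hom(Y, Q) is restricted from X. *)
Lemma reflexive_kernel X X' Y (i : 'Hom(Y, X)) (g : 'Hom(X, X')) :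
    rinjective Q -> is_rhom i -> is_rhom g -> lker i = 0%VS -> limg i = lker g ->
    reflexive_wrt X -> torsionless X' ->
  reflexive_wrt Y.
Proof.
move=> injQ ih gh i0 ig reflX torX' z zl zb.
have [||x xP] := reflX (fun h => z (h \o i)%VF).
- by move=> k h h' hh h'h; rewrite comp_lfunDl -comp_lfunZl zl //; apply: rhom_comp.
- by move=> beta h bh hh; rewrite -comp_lfunA zb //; apply: rhom_comp.
have z0 : z 0 = 0.
  have := zl (-1) _ _ (@rhom0 _ _ Y Q) (@rhom0 _ _ Y Q).
  by rewrite scaler0 addr0 scaleN1r addNr.
have : x \in lker g.
  rewrite memv_ker; apply/eqP/torX' => h hh; rewrite -comp_lfunE -xP; last exact: rhom_comp.
  suff -> : ((h \o g) \o i)%VF = 0 by [].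
  apply/lfunP=> y; rewrite !comp_lfunE zero_lfunE.
  have : i y \in lker g by rewrite -ig; apply/mem_limg; exists y.
  by rewrite memv_ker => /eqP->; rewrite linear0.
rewrite -ig => /mem_limg[y yx]; exists y => h hh.
have [h' h'h hE] := injQ _ _ i h ih hh i0.
by rewrite -{1}hE xP // -yx -comp_lfunE hE.
Qed.

(** With j : Y -> Q^n given by a basis (h_i) of Hom(Y, Q), a vector w in Q^n
    is the functional z with z h_i = w_i. If w is killed by all maps Q^n -> Q
    that vanish on j Y, then z commutes with End(Q), so w is in the image of j.
    A basis of these maps gives d. *)
Lemma copresentation_of_reflexive Y : reflexive_wrt Y -> torsionless Y ->
  exists n m (j : 'Hom(Y, rpow n Q)) (d : 'Hom(rpow n Q, rpow m Q)),
    [/\ is_rhom j, is_rhom d, lker j = 0%VS & lker d = limg j].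
Proof.
move=> reflY torY; pose H := homv Y Q.
have [|j jh jE] := @rhoms_as_one _ _ Y Q H; first by move=> h /homvP.
have j0 : lker j = 0%VS.
  apply: inj_lker0 => y /(rhoms_as_one_eq0 y jE) hy; apply: torY => h hh.
  by apply: hy; apply/homvP.
pose W := rpow (\dim H) Q.
have lc : linear (fun h : 'Hom(W, Q) => (h \o j)%VF).
  by move=> k h h'; rewrite comp_lfunDl -comp_lfunZl.
pose H2 := (homv W Q :&: lker (linfun (fun h : 'Hom(W, Q) => (h \o j)%VF)))%VS.
have H2P h : h \in H2 <-> is_rhom h /\ (h \o j)%VF = 0.
  rewrite memv_cap [X in _ && X]memv_ker linfunE //.
  split=> [/andP[/homvP hh /eqP hj] | [hh hj]].
    by [].
  by apply/andP; split; [apply/homvP | apply/eqP].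
have [|d dh dE] := @rhoms_as_one _ _ W Q H2; first by move=> h /H2P[].
exists (\dim H), (\dim H2), j, d; split=> //.
apply/vspaceP=> w; apply/idP/idP=> [|/mem_limg[y <-]]; last first.
  rewrite memv_ker; apply/eqP/(rhoms_as_one_eq0 (j y) dE) => h /H2P[_ hj].
  by rewrite -comp_lfunE hj zero_lfunE.
rewrite memv_ker => /eqP/(rhoms_as_one_eq0 w dE) hw.
pose f h (i : 'I_(\dim H)) : 'End(Q) := coord (vbasis H) i h *: \1%VF.
have fh h i : is_rhom (f h i).
  by move=> v a; rewrite /f !scale_lfunE !id_lfunE ractZ.
(* c h is the linear combination of the projections which h = c h \o j uses. *)
have cex h : exists c : 'Hom(W, Q), is_rhom c /\
    forall v : W, c v = \sum_i coord (vbasis H) i h *: (v : {ffun 'I_(\dim H) -> Q}) i.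
  have [c ch cE] := rpow_copair (fh h); exists c; split=> // v; rewrite cE.
  by apply: eq_bigr => i _; rewrite scale_lfunE id_lfunE.
pose c h := proj1_sig (constructive_indefinite_description _ (cex h)).
have [ch cE] : (forall h, is_rhom (c h)) /\ forall h (v : W),
    c h v = \sum_i coord (vbasis H) i h *: (v : {ffun 'I_(\dim H) -> Q}) i.
  by split=> h; rewrite /c; case: constructive_indefinite_description => ? [].
have cj h y : is_rhom h -> c h (j y) = h y.
  move=> /homvP hH; rewrite cE [in RHS](coord_vbasis hH) sum_lfunE.
  by apply: eq_bigr => i _; rewrite jE scale_lfunE.
have [||y yP] := reflY (fun h => c h w).
- move=> k h h' hh h'h; rewrite !cE scaler_sumr -big_split; apply: eq_bigr => i _ /=.
  by rewrite linearP scalerDl scalerA.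
- move=> beta h bh hh; apply/eqP; rewrite -subr_eq0 -comp_lfunE.
  have <- : (c (beta \o h)%VF - (beta \o c h)%VF) w = c (beta \o h)%VF w - (beta \o c h)%VF w.
    by rewrite add_lfunE opp_lfunE.
  apply/eqP/hw/H2P; split; first by apply: rhomB => //; apply: rhom_comp.
  apply/lfunP=> y; rewrite comp_lfunE zero_lfunE add_lfunE opp_lfunE comp_lfunE !cj //.
    by rewrite comp_lfunE subrr.
  exact: rhom_comp.
apply/mem_limg; exists y; apply/ffunP=> i; rewrite jE.
have iH : (vbasis H)`_i \in H by apply/vbasis_mem/mem_nth; rewrite size_tuple.
rewrite -yP; last exact/homvP.
rewrite cE (bigD1 i) //= coord_free ?(basis_free (vbasisP H)) // eqxx scale1r big1 ?addr0 //.
move=> k ki; rewrite coord_free ?(basis_free (vbasisP H)) //.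
case: eqP => [e | _]; last by rewrite scale0r.
by rewrite e eqxx in ki.
Qed.

End Copresented.

(** * Endomorphism algebras of generators of symmetric algebras *)

(** The properties of a gendo-symmetric algebra on which the theorem rests.
    The relation nk_rel is the graph of a natural map D(P) -> Hom(P, A) of left
    A-modules, or dually of a map from the Nakayama functor to the identity. It
    is invertible on powers of nk_mod. *)
Record nakayama_datum (K : fieldType) (A : falgType K) := NakayamaDatum {
  nk_mod : rmodule A;
  nk_rel : forall P : rmodule A, 'Hom(P, K^o) -> 'Hom(P, rregular A) -> Prop;
  nk_projective : rprojective nk_mod;
  nk_injective : rinjective nk_mod;
  nk_torsionless : torsionless nk_mod (rregular A);
  nk_reflexive : reflexive_wrt nk_mod (rregular A);
  nk_exists : forall (P : rmodule A) (g : 'Hom(P, K^o)),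
    exists2 u : 'Hom(P, rregular A), is_rhom u & nk_rel g u;
  nk_uniq : forall (P : rmodule A) (g : 'Hom(P, K^o)) (u u' : 'Hom(P, rregular A)),
    nk_rel g u -> nk_rel g u' -> u = u';
  nk_comp : forall (P P' : rmodule A) (f : 'Hom(P, P')) g u,
    is_rhom f -> nk_rel g u -> @nk_rel P (g \o f)%VF (u \o f)%VF;
  nk_lin : forall (P : rmodule A) c (g g' : 'Hom(P, K^o)) u u',
    nk_rel g u -> nk_rel g' u' -> nk_rel (c *: g + g') (c *: u + u');
  nk_act : forall (P : rmodule A) (g : 'Hom(P, K^o)) (u u' : 'Hom(P, rregular A)) a,
    nk_rel g u -> (forall x, (u' x : A) = a * (u x : A)) ->
    nk_rel (g \o racto P a)%VF u';
  nk_rpow_exists : forall n (u : 'Hom(rpow n nk_mod, rregular A)),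
    is_rhom u -> exists g, nk_rel g u;
  nk_rpow_inj : forall n (g : 'Hom(rpow n nk_mod, K^o)), nk_rel g 0 -> g = 0
}.

Section GendoSymmetric.
Variables (K : fieldType) (A B : falgType K) (N : rmodule B).

Variable phi : A -> 'End(N).
Hypothesis phi_linear : linear phi.
Hypothesis phi_inj : injective phi.
Hypothesis phi1 : phi 1 = \1%VF.
Hypothesis phiM : forall a b, phi (a * b) = (phi a \o phi b)%VF.
Hypothesis phi_onto : forall f, is_rhom f <-> exists a, f = phi a.

Variable tr : 'Hom(B, K^o).
Hypothesis trC : forall x y : B, tr (x * y) = tr (y * x).
Hypothesis tr_represent : forall l : 'Hom(B, K^o), exists x, forall y, l y = tr (x * y).
Hypothesis tr_nondeg : forall x, (forall y, tr (x * y) = 0) -> x = 0.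

Variables (k : nat) (gu : 'I_k -> 'Hom(N, rregular B)) (gn : 'I_k -> N).
Hypothesis gu_hom : forall i, is_rhom (gu i).
Hypothesis gu_gn : \sum_i (gu i (gn i) : B) = 1.

Implicit Types (a : A) (b : B) (m n : N) (P Y : rmodule A).

Lemma phi_hom a n b : phi a (n *> b) = phi a n *> b.
Proof. by have : is_rhom (phi a) by [apply/phi_onto; exists a]; apply. Qed.

Lemma phi_ext a a' : (forall n, phi a n = phi a' n) -> a = a'.
Proof. by move=> e; apply/phi_inj/lfunP. Qed.

Lemma phi0 : phi 0 = 0.
Proof. by have := phi_linear (-1) 0 0; rewrite scaler0 addr0 scaleN1r addNr. Qed.

Definition dualN : rmodule A.
Proof.
apply: (@RModule K A 'Hom(N, K^o) (fun xi a => (xi \o phi a)%VF)).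
- by move=> a c f g; apply/lfunP=> v; rewrite !(comp_lfunE, add_lfunE, scale_lfunE).
- move=> f c a b; apply/lfunP=> v.
  by rewrite !(comp_lfunE, add_lfunE, scale_lfunE) phi_linear add_lfunE scale_lfunE linearP.
- by move=> f; rewrite phi1 comp_lfun1r.
- by move=> f a b; rewrite phiM comp_lfunA.
Defined.

Notation Q := dualN.

Definition ev (xi : Q) (n : N) : K^o := (xi : 'Hom(N, K^o)) n.

Lemma ev_act (xi : Q) a n : ev (xi *> a) n = ev xi (phi a n).
Proof. by rewrite /ev comp_lfunE. Qed.

Lemma ev_linl c (xi zeta : Q) n : ev (c *: xi + zeta) n = c *: ev xi n + ev zeta n.
Proof. by rewrite /ev add_lfunE scale_lfunE. Qed.

Lemma ev_linr c (xi : Q) n n' : ev xi (c *: n + n') = c *: ev xi n + ev xi n'.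
Proof. by rewrite /ev linearP. Qed.

Lemma ev_ext (xi zeta : Q) : (forall n, ev xi n = ev zeta n) -> xi = zeta.
Proof. by move=> e; apply/lfunP. Qed.

Lemma ev_eq n n' : (forall xi, ev xi n = ev xi n') -> n = n'.
Proof.
move=> e; apply/eqP; rewrite -subr_eq0; apply/eqP/separate0 => xi.
by rewrite linearB /= -/(ev xi n) e subrr.
Qed.

Lemma ev_sum I (r : seq I) (F : I -> Q) n :
  ev (\sum_(i <- r) F i) n = \sum_(i <- r) ev (F i) n.
Proof. by rewrite /ev sum_lfunE. Qed.

(** The symmetrizing form tr of B turns a K-linear form on N into a B-linear
    map from N to B; this identifies D(N) with Hom_B(N, B). *)
Lemma form_exists (xi : Q) n : exists x, forall b, tr (x * b) = ev xi (n *> b).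
Proof.
have l : linear (fun b : B => ev xi (n *> b)).
  by move=> c x y; rewrite ract_linr ev_linr.
by have [x xE] := tr_represent (linfun (fun b : B => ev xi (n *> b)));
  exists x => b; rewrite -xE linfunE.
Qed.

Definition form (xi : Q) n : B :=
  proj1_sig (constructive_indefinite_description _ (form_exists xi n)).

Lemma formE xi n b : tr (form xi n * b) = ev xi (n *> b).
Proof. by rewrite /form; case: constructive_indefinite_description. Qed.

Lemma form_uniq xi n x : (forall b, tr (x * b) = ev xi (n *> b)) -> form xi n = x.
Proof.
move=> xE; apply/eqP; rewrite -subr_eq0; apply/eqP/tr_nondeg => b.
by rewrite mulrBl linearB /= formE xE subrr.
Qed.

Lemma tr_form xi n : tr (form xi n) = ev xi n.
Proof. by rewrite -[form xi n]mulr1 formE ract1. Qed.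

Lemma form_linr c xi n n' : form xi (c *: n + n') = c *: form xi n + form xi n'.
Proof.
apply: form_uniq => b; rewrite mulrDl -scalerAl linearP /= !formE.
by rewrite ractD ractZ ev_linr.
Qed.

Lemma form_linl c xi zeta n : form (c *: xi + zeta) n = c *: form xi n + form zeta n.
Proof.
by apply: form_uniq => b; rewrite mulrDl -scalerAl linearP /= !formE ev_linl.
Qed.

Lemma form_mulr xi n b : form xi (n *> b) = form xi n * b.
Proof. by apply: form_uniq => x; rewrite -mulrA formE ractM. Qed.

Lemma form_act xi a n : form (xi *> a) n = form xi (phi a n).
Proof. by apply: form_uniq => x; rewrite formE ev_act phi_hom. Qed.

(** These endomorphisms span the image of N (x)_B Hom_B(N, B) in A. *)
Lemma rank1_exists m (xi : Q) : exists a, forall n, phi a n = m *> form xi n.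
Proof.
have l : linear (fun n : N => m *> form xi n).
  by move=> c x y; rewrite form_linr ract_linr.
have [|a aE] := (phi_onto (linfun (fun n : N => m *> form xi n))).1.
  by move=> n b; rewrite !linfunE // form_mulr ractM.
by exists a => n; rewrite -aE linfunE.
Qed.

Definition rank1 m xi : A :=
  proj1_sig (constructive_indefinite_description _ (rank1_exists m xi)).

Lemma rank1E m xi n : phi (rank1 m xi) n = m *> form xi n.
Proof. by rewrite /rank1; case: constructive_indefinite_description. Qed.

Lemma phi_lin c a a' n : phi (c *: a + a') n = c *: phi a n + phi a' n.
Proof. by rewrite phi_linear add_lfunE scale_lfunE. Qed.

Lemma rank1_linl c m m' xi : rank1 (c *: m + m') xi = c *: rank1 m xi + rank1 m' xi.
Proof. by apply: phi_ext => n; rewrite phi_lin !rank1E ract_linearl. Qed.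

Lemma rank1_linr c m xi zeta :
  rank1 m (c *: xi + zeta) = c *: rank1 m xi + rank1 m zeta.
Proof. by apply: phi_ext => n; rewrite phi_lin !rank1E form_linl ract_linr. Qed.

Lemma rank1_actr m xi a : rank1 m (xi *> a) = rank1 m xi * a.
Proof. by apply: phi_ext => n; rewrite phiM comp_lfunE !rank1E form_act. Qed.

Lemma ev_rank1 zeta m xi n : ev zeta (phi (rank1 m xi) n) = tr (form xi n * form zeta m).
Proof. by rewrite rank1E -tr_form form_mulr trC. Qed.

Definition shift b (xi : Q) : Q := (xi \o racto N b)%VF.

Lemma shiftE b xi n : ev (shift b xi) n = ev xi (n *> b).
Proof. by rewrite /ev comp_lfunE ractoE. Qed.

Lemma form_shift b xi n : form (shift b xi) n = b * form xi n.
Proof.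
by apply: form_uniq => x; rewrite shiftE -ractM -mulrA trC -mulrA formE.
Qed.

Lemma rank1_balanced m b xi : rank1 (m *> b) xi = rank1 m (shift b xi).
Proof. by apply: phi_ext => n; rewrite !rank1E form_shift ractM. Qed.

(** The partition of unity of B given by the generator N makes the elements
    tr \o gu i and the maps rank1 (gn i) a dual basis of D(N). *)
Lemma rank1_partition (xi : Q) :
  xi = \sum_i ((tr \o gu i)%VF : Q) *> rank1 (gn i) xi.
Proof.
apply: ev_ext => n; rewrite ev_sum -[in LHS]tr_form -[form xi n]mul1r -gu_gn.
rewrite mulr_suml linear_sum; apply: eq_bigr => i _ /=.
by rewrite ev_act rank1E /ev comp_lfunE gu_hom.
Qed.

Lemma projective_dualN : rprojective Q.
Proof.
move=> X Y g f gh fh g1.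
have /fin_all_exists[x xE] : forall i : 'I_k, exists x, g x = f (tr \o gu i)%VF.
  by move=> i; apply: ((limg_fullP g).1 g1).
pose h (xi : Q) := \sum_i x i *> rank1 (gn i) xi.
have hl : linear h.
  move=> c xi zeta; rewrite /h scaler_sumr -big_split; apply: eq_bigr => i _.
  by rewrite rank1_linr ract_linr.
exists (linfun h) => [xi a|].
  rewrite !linfunE // /h ract_sum; apply: eq_bigr => i _.
  by rewrite rank1_actr ractM.
apply/lfunP=> xi; rewrite comp_lfunE linfunE // linear_sum.
rewrite [in RHS](rank1_partition xi) linear_sum; apply: eq_bigr => i _ /=.
by rewrite gh xE fh.
Qed.

(** Every n is the sum of the elements rank1 n (tr \o gu i) applied to gn i, so
    N is a projective left A-module. A homomorphism f : X -> D(N) is thus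
    determined by the linear forms x |-> f x (gn i), and linear forms extend to
    larger modules. *)
Lemma injective_dualN : rinjective Q.
Proof.
move=> X Y g f gh fh g0.
have nE n : n = \sum_i phi (rank1 n (tr \o gu i)%VF) (gn i).
  rewrite -[LHS](ract1 n) -gu_gn ract_sumr; apply: eq_bigr => i _.
  rewrite rank1E; congr (_ *> _); apply/esym/form_uniq => b.
  by rewrite /ev comp_lfunE gu_hom.
have /fin_all_exists[l lE] : forall i : 'I_k, exists l : 'Hom(Y, K^o),
    forall x, l (g x) = ev (f x) (gn i).
  move=> i; have fl : linear (fun x : X => ev (f x) (gn i)).
    by move=> c x y; rewrite linearP ev_linl.
  have [|l lE] := @hom_extend _ _ _ _ g (linfun (fun x : X => ev (f x) (gn i))).
    by rewrite g0 sub0v.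
  by exists l => x; rewrite -comp_lfunE -lE linfunE.
have hex (y : Y) : exists xi : Q,
    forall n, ev xi n = \sum_i l i (y *> rank1 n (tr \o gu i)%VF).
  have hl : linear (fun n : N => \sum_i l i (y *> rank1 n (tr \o gu i)%VF)).
    move=> c n n'; rewrite scaler_sumr -big_split; apply: eq_bigr => i _.
    by rewrite rank1_linl ract_linr linearP.
  by exists (linfun (fun n : N => \sum_i l i (y *> rank1 n (tr \o gu i)%VF))) => n;
    rewrite /ev linfunE.
have rank1_actl a n xi : rank1 (phi a n) xi = a * rank1 n xi.
  by apply: phi_ext => n'; rewrite phiM comp_lfunE !rank1E phi_hom.
pose R (y : Y) (xi : Q) := forall n, ev xi n = \sum_i l i (y *> rank1 n (tr \o gu i)%VF).
have [|||h hh hR] := @rhom_of_rel _ _ Y Q R hex.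
- move=> xi Rxi; apply: ev_ext => n; rewrite Rxi big1 => [|i _].
    by rewrite /ev zero_lfunE.
  by rewrite ract0 linear0.
- move=> c y xi y' xi' e e' n; rewrite ev_linl e e' scaler_sumr -big_split.
  by apply: eq_bigr => i _; rewrite ract_linearl linearP.
- move=> y xi a e n; rewrite ev_act e; apply: eq_bigr => i _.
  by rewrite rank1_actl ractM.
exists h => //; apply/lfunP=> x; rewrite comp_lfunE; apply: ev_ext => n.
rewrite hR [in RHS](nE n) [RHS]linear_sum; apply: eq_bigr => i _ /=.
by rewrite -gh lE fh ev_act.
Qed.

Lemma torsionless_regular : torsionless Q (rregular A).
Proof.
move=> a ha; apply/phi_inj/lfunP=> n; apply: ev_eq => xi.
have := ha _ (rhom_orbit_map xi); rewrite orbit_mapE => xa.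
by rewrite -ev_act xa phi0 zero_lfunE /ev linear0 zero_lfunE.
Qed.

(** The regular module is Hom_B(N, N): compatibility with the maps given by
    right multiplications with elements of B forces a linear endomorphism of
    D(N) to be the transpose of an element of A. *)
Lemma reflexive_regular : reflexive_wrt Q (rregular A).
Proof.
move=> z zl zb.
have om_lin c xi zeta : orbit_map (c *: xi + zeta : Q) = c *: orbit_map xi + orbit_map zeta.
  apply/lfunP=> a; rewrite add_lfunE scale_lfunE !orbit_mapE.
  exact: ract_linearl.
have sl b : linear (shift b).
  by move=> c xi zeta; apply: ev_ext => n; rewrite ev_linl !shiftE ev_linl.
have sh b : is_rhom (linfun (shift b) : 'End(Q)).
  move=> xi a; rewrite !linfunE //; apply: ev_ext => n.
  by rewrite shiftE !ev_act shiftE phi_hom.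
pose R n n' := forall xi : Q, ev xi n' = ev (z (orbit_map xi)) n.
have [||||F Fh FR] := @rhom_of_rel _ _ N N R.
- move=> n.
  have Gl : linear (fun xi : 'Hom(N, K^o) => ev (z (orbit_map (xi : Q))) n).
    by move=> c xi zeta; rewrite om_lin zl ?ev_linl //; apply: rhom_orbit_map.
  have [n' n'E] := bidual_evaluation
    (linfun (fun xi : 'Hom(N, K^o) => ev (z (orbit_map (xi : Q))) n)).
  by exists n' => xi; rewrite /ev -n'E linfunE.
- by move=> n Rn; apply: ev_eq => xi; rewrite Rn /ev !linear0.
- by move=> c n m n' m' e e' xi; rewrite !ev_linr e e'.
- move=> n n' b e xi; rewrite -!shiftE e.
  have -> : orbit_map (shift b xi) = (linfun (shift b) \o orbit_map xi)%VF.
    apply/lfunP=> a; rewrite comp_lfunE !orbit_mapE linfunE //.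
    by apply: ev_ext => m; rewrite shiftE !ev_act shiftE phi_hom.
  rewrite zb //; last exact: rhom_orbit_map.
  by rewrite linfunE.
have [a aE] := (phi_onto F).1 Fh; exists a => h hh; rewrite (rhom_regularE hh).
by rewrite orbit_mapE; apply: ev_ext => n; rewrite ev_act -aE FR.
Qed.

(** Pairs of a linear form on P and a homomorphism P -> A that correspond to
    each other under D(P) -> Hom(P, A), the natural map which D(A) -> A, the
    evaluation D(A) = N (x)_B Hom_B(N, B) -> End_B(N), induces. Stated as a
    relation, it is visibly natural in P and needs no tensor product. *)
Definition trace_rel P (g : 'Hom(P, K^o)) (u : 'Hom(P, rregular A)) : Prop :=
  forall (x : P) m (zeta : Q), ev zeta (phi (u x) m) = g (x *> rank1 m zeta).

Lemma trace_rel_uniq P (g : 'Hom(P, K^o)) (u u' : 'Hom(P, rregular A)) :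
  trace_rel g u -> trace_rel g u' -> u = u'.
Proof.
move=> e e'; apply/lfunP=> x; apply: phi_ext => m; apply: ev_eq => zeta.
by rewrite e e'.
Qed.

Lemma trace_rel_comp P P' (f : 'Hom(P, P')) g u :
  is_rhom f -> trace_rel g u -> trace_rel (g \o f)%VF (u \o f)%VF.
Proof. by move=> fh e x m zeta; rewrite !comp_lfunE e fh. Qed.

Lemma trace_rel_lin P c (g g' : 'Hom(P, K^o)) u u' :
  trace_rel g u -> trace_rel g' u' -> trace_rel (c *: g + g') (c *: u + u').
Proof.
move=> e e' x m zeta.
by rewrite !add_lfunE !scale_lfunE [phi _]phi_linear add_lfunE scale_lfunE ev_linr e e'.
Qed.

Lemma trace_rel_act P (g : 'Hom(P, K^o)) (u u' : 'Hom(P, rregular A)) a :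
    trace_rel g u -> (forall x, (u' x : A) = a * (u x : A)) ->
  trace_rel (g \o racto P a)%VF u'.
Proof.
move=> e u'E x m zeta; rewrite u'E phiM comp_lfunE -ev_act e rank1_actr ractM.
by rewrite comp_lfunE ractoE.
Qed.

Lemma trace_rel_exists P (g : 'Hom(P, K^o)) :
  exists2 u : 'Hom(P, rregular A), is_rhom u & trace_rel g u.
Proof.
pose R (x : P) (a : rregular A) :=
  forall m (zeta : Q), ev zeta (phi (a : A) m) = g (x *> rank1 m zeta).
apply: (@rhom_of_rel _ _ P (rregular A) R).
- move=> x.
  pose S m n := forall zeta : Q, ev zeta n = g (x *> rank1 m zeta).
  have [||||F Fh FS] := @rhom_of_rel _ _ N N S.
  + move=> m.
    have Gl : linear (fun zeta : 'Hom(N, K^o) => g (x *> rank1 m (zeta : Q))).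
      by move=> c xi zeta; rewrite rank1_linr ract_linr linearP.
    have [n nE] := bidual_evaluation
      (linfun (fun zeta : 'Hom(N, K^o) => g (x *> rank1 m (zeta : Q)))).
    by exists n => zeta; rewrite /ev -nE linfunE.
  + move=> n Sn; apply: ev_eq => zeta; rewrite Sn.
    have -> : rank1 0 zeta = 0.
      by have := rank1_linl (-1) 0 0 zeta; rewrite scaler0 addr0 scaleN1r addNr.
    by rewrite ractr0 /ev !linear0.
  + move=> c m n m' n' e e' zeta.
    by rewrite ev_linr e e' rank1_linl ract_linr linearP.
  + by move=> m n b e zeta; rewrite -shiftE e rank1_balanced.
  have [a aE] := (phi_onto F).1 Fh; exists a => m zeta; rewrite -aE; exact: FS.
- move=> a Ra; apply: phi_ext => m; apply: ev_eq => zeta.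
  rewrite Ra ract0 linear0.
  by rewrite phi0 zero_lfunE /ev linear0.
- move=> c x a x' a' e e' m zeta.
  by rewrite phi_lin ev_linr e e' ract_linearl linearP.
- move=> x a b e m zeta.
  rewrite -[(a *> b : A)]/((a : A) * b) phiM comp_lfunE e -ractM.
  congr (g (_ *> _)).
  by apply: phi_ext => n; rewrite phiM comp_lfunE !rank1E phi_hom.
Qed.

Definition trace_bijective P : Prop :=
  (forall u : 'Hom(P, rregular A), is_rhom u -> exists g, trace_rel g u) /\
  (forall g : 'Hom(P, K^o), trace_rel g 0 -> g = 0).

Lemma ev_faithful n : (forall xi zeta m, ev xi (m *> form zeta n) = 0) -> n = 0.
Proof.
move=> h; apply: ev_eq => zeta; rewrite [RHS]linear0 -tr_form.
rewrite -[form _ _]mul1r -gu_gn mulr_suml linear_sum big1 // => i _ /=.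
have := h (tr \o gu i)%VF zeta (gn i); by rewrite /ev comp_lfunE gu_hom.
Qed.

(** D(D(N)) is N, and n in N corresponds to the homomorphism
    xi |-> n (form xi _) from Hom_B(N, B) to End_B(N). A homomorphism u is of
    this form for n read off on the dual basis of rank1_partition. *)
Lemma trace_bijective_dualN : trace_bijective Q.
Proof.
split=> [u uh | g g0].
  pose n := \sum_i phi (u (tr \o gu i)%VF : A) (gn i).
  have gl : linear (fun xi : Q => ev xi n) by move=> c xi zeta; apply: ev_linl.
  exists (linfun (fun xi : Q => ev xi n)) => xi m zeta.
  rewrite linfunE // ev_act.
  rewrite [in LHS](rank1_partition xi) linear_sum.
  have phi_sum (F : 'I_k -> A) x : phi (\sum_i F i) x = \sum_i phi (F i) x.
    pose phi' : 'Hom(A, 'End(N)) := linfun phi.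
    have e a : phi a = phi' a by rewrite linfunE.
    rewrite e linear_sum sum_lfunE; apply: eq_bigr => i _ /=.
    by rewrite e.
  rewrite phi_sum.
  have -> : \sum_i phi (u (((tr \o gu i)%VF : Q) *> rank1 (gn i) xi)) m = n *> form xi m.
    rewrite /n ract_sum; apply: eq_bigr => i _.
    by rewrite uh [phi _]phiM comp_lfunE rank1E phi_hom.
  by rewrite ev_rank1 -tr_form form_mulr trC.
have [n nE] := bidual_evaluation (g : 'Hom('Hom(N, K^o), K^o)).
suff n0 : n = 0 by apply/lfunP=> xi; rewrite nE n0 linear0 zero_lfunE.
apply: ev_faithful => xi zeta m.
rewrite -rank1E -ev_act; have := g0 xi m zeta; rewrite zero_lfunE nE -/(ev _ n) => <-.
by rewrite phi0 zero_lfunE /ev linear0.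
Qed.

Lemma trace_rel_sum r P (g : 'I_r -> 'Hom(P, K^o)) (u : 'I_r -> 'Hom(P, rregular A)) :
  (forall i, trace_rel (g i) (u i)) -> trace_rel (\sum_i g i) (\sum_i u i).
Proof.
move=> e; elim: (index_enum _) => [|i l IH]; last first.
  by rewrite !big_cons -[g i]scale1r -[u i]scale1r; apply: trace_rel_lin.
rewrite !big_nil => x m zeta; rewrite !zero_lfunE.
by rewrite phi0 zero_lfunE /ev linear0.
Qed.

Lemma trace_bijective_rpow r P : trace_bijective P -> trace_bijective (rpow r P).
Proof.
move=> [tb1 tb2]; have [j jh jE] := rpow_injs r P.
have /fin_all_exists[p pP] : forall i : 'I_r, exists p : 'Hom(rpow r P, P),
    is_rhom p /\ forall v : rpow r P, p v = (v : {ffun 'I_r -> P}) i.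
  by move=> i; have [p ph pE] := rpow_proj P i; exists p.
have decomp (Z : vectType K) (h : 'Hom(rpow r P, Z)) : h = \sum_i ((h \o j i) \o p i)%VF.
  apply/lfunP=> v; rewrite {1}(rpow_sum v jE) linear_sum sum_lfunE.
  by apply: eq_bigr => i _; rewrite /= !comp_lfunE (pP i).2.
split=> [u uh | g g0].
  have /fin_all_exists[g gP] : forall i : 'I_r, exists g, trace_rel g (u \o j i)%VF.
    by move=> i; apply/tb1/rhom_comp.
  exists (\sum_i (g i \o p i))%VF; rewrite [u]decomp; apply: trace_rel_sum => i.
  exact: trace_rel_comp (pP i).1 (gP i).
rewrite [g]decomp big1 // => i _; rewrite [(g \o j i)%VF]tb2 ?comp_lfun0l //.
by have := trace_rel_comp (jh i) g0; rewrite comp_lfun0l.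
Qed.

Lemma nakayama_datum_exists : inhabited (nakayama_datum A).
Proof.
have tb r := trace_bijective_rpow r trace_bijective_dualN.
split; apply: (@NakayamaDatum K A Q trace_rel).
- exact: projective_dualN.
- exact: injective_dualN.
- exact: torsionless_regular.
- exact: reflexive_regular.
- exact: trace_rel_exists.
- exact: trace_rel_uniq.
- exact: trace_rel_comp.
- exact: trace_rel_lin.
- exact: trace_rel_act.
- by move=> r; case: (tb r).
- by move=> r; case: (tb r).
Qed.

End GendoSymmetric.

Lemma symmetric_trace (K : fieldType) (B : falgType K) : symmetric_alg B ->
  exists tr : 'Hom(B, K^o), [/\ forall x y : B, tr (x * y) = tr (y * x),
    forall l : 'Hom(B, K^o), exists x : B, forall y, l y = tr (x * y)
  & forall x : B, (forall y, tr (x * y) = 0) -> x = 0].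
Proof.
move=> [psi [psi0 psi1 psiE]]; exists (psi 1).
have psiL x y : psi x y = psi 1 (x * y).
  by have := psiE 1 x 1 y; rewrite !mul1r mulr1.
have psiR x y : psi x y = psi 1 (y * x).
  by have := psiE x 1 1 y; rewrite !mulr1 mul1r.
split=> [x y | l | x xP].
- by rewrite -psiL -psiR.
- by have [x <-] := (limg_fullP psi).1 psi1 l; exists x => y; apply: psiL.
- by apply: (lker0_inj psi0); apply/lfunP=> y; rewrite psiL xP zero_lfunE.
Qed.

Lemma generator_partition (K : fieldType) (B : falgType K) (N : rmodule B) :
  generator N -> exists k (gu : 'I_k -> 'Hom(N, rregular B)) (gn : 'I_k -> N),
    (forall i, is_rhom (gu i)) /\ \sum_i (gu i (gn i) : B) = 1.
Proof.
move=> /(_ (rregular B))[k [gu [guh gu1]]].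
have : (1 : rregular B) \in (\sum_(i < k) limg (gu i))%VS by rewrite gu1 memvf.
move=> /memv_sumP[v vP ->].
have /fin_all_exists[gn gnE] : forall i, exists n, gu i n = v i.
  by move=> i; apply/mem_limg/vP.
by exists k, gu, gn; split=> //; apply: eq_bigr.
Qed.

Lemma gendo_symmetric_datum (K : fieldType) (A : falgType K) :
  gendo_symmetric A -> inhabited (nakayama_datum A).
Proof.
move=> [B [N [/symmetric_trace[tr [trC tr_rep tr_nd]] genN]]].
have [k [gu [gn [guh gu1]]]] := generator_partition genN.
move=> [phi [phi_lin phi_inj [phi1 phiM] phi_onto]].
exact: (nakayama_datum_exists phi_lin phi_inj phi1 phiM phi_onto trC tr_rep tr_nd guh gu1).
Qed.

(** * Transposes and second syzygies *)

Section HomIntoAlgebra.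
Variables (K : fieldType) (A : falgType K).
Implicit Types P : rmodule A.

Lemma homA_hom P (h : homA P) : is_rhom (vsval h).
Proof. by apply/homvP/subvsP. Qed.

Definition homA_of P (u : 'Hom(P, rregular A)) : homA P :=
  vsproj (homv P (rregular A)) u.

Lemma homA_ofE P (u : 'Hom(P, rregular A)) : is_rhom u -> vsval (homA_of u) = u.
Proof. by move=> uh; rewrite vsprojK //; apply/homvP. Qed.

Lemma homA_inj P (h h' : homA P) : (forall x, vsval h x = vsval h' x) -> h = h'.
Proof. by move=> e; apply/val_inj/lfunP. Qed.

Lemma homA_lin P c (h h' : homA P) : vsval (c *: h + h') = c *: vsval h + vsval h'.
Proof. by rewrite linearP. Qed.

Lemma homA_ract P (h : homA P) (a : A^c) x :
  vsval (h *> a) x = (a : A) * (vsval h x : A).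
Proof. exact: homA_actE. Qed.

Lemma homA_sum P n (h : 'I_n -> homA P) x :
  vsval (\sum_i h i) x = \sum_i vsval (h i) x.
Proof. by rewrite linear_sum sum_lfunE. Qed.

End HomIntoAlgebra.

Section ProjectiveInjectiveSummands.
Variables (K : fieldType) (A : falgType K).
Implicit Types M P Q X Y : rmodule A.

(** Replace r s by an endomorphism w of minimal rank among those that fix f and
    factor through r, and let e be its Fitting idempotent. Then 1 - e vanishes
    on the image of f, hence factors through M, which makes its image a
    summand of M; and e factors through the injective module Q. *)
Lemma injective_of_factor M P0 P1 Q (p : 'Hom(P0, M)) (f : 'Hom(P1, P0))
    (r : 'Hom(Q, P0)) (s : 'Hom(P0, Q)) :
    rprojective P0 -> is_rhom p -> limg p = fullv ->
    is_rhom f -> limg f = lker p ->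
    rinjective Q -> is_rhom r -> is_rhom s -> (r \o s \o f)%VF = f ->
    (forall P : rmodule A, rsummand P M -> rprojective P -> rinjective P) ->
  rinjective P0.
Proof.
move=> projP0 ph p1 fh fp injQ rh sh rsf summ.
pose good (w : 'End(P0)) := [/\ is_rhom w, (w \o f)%VF = f
  & exists2 u : 'Hom(P0, Q), is_rhom u & w = (r \o u)%VF].
have [|w [wh wf [u uh wu]] wmin] := @exists_minimizer _ good (fun w => \dim (limg w)).
  by exists (r \o s)%VF; split=> //; [apply: rhom_comp | exists s].
have ww : (limg w <= limg (w \o w))%VS.
  rewrite -(geq_leqif (dimv_leqif_sup _)); last by rewrite limg_comp limgS ?subvf.
  apply: wmin; split; [exact: rhom_comp | by rewrite -comp_lfunA !wf |].
  by exists (u \o w)%VF; [apply: rhom_comp | rewrite comp_lfunA -wu].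
have [e [t [eh th ew eid wt]]] := fitting_idempotent wh ww.
have ee x : e (e x) = e x.
  have /mem_limg[y <-] : e x \in limg w by rewrite -ew; apply/mem_limg; exists x.
  exact: eid.
have ef x : e (f x) = f x.
  have <- : w (f x) = f x by rewrite -comp_lfunE wf.
  exact: eid.
pose e' : 'End(P0) := (\1 - e)%VF.
have e'E x : e' x = x - e x by rewrite add_lfunE opp_lfunE id_lfunE.
have e'h : is_rhom e' by apply: rhomB => //; apply: rhom_id.
have e'e' x : e' (e' x) = e' x by rewrite !e'E linearB /= ee subrr subr0.
have [sp sph spE] : exists2 sp : 'Hom(M, P0), is_rhom sp & (sp \o p)%VF = e'.
  apply: rhom_factor_surj => //; rewrite -fp; apply/subvP=> _ /mem_limg[x <-].
  by rewrite memv_ker e'E ef subrr.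
have [P2 [i [ih i0 iE]]] := submodule_embedding (submodule_limg e'h).
have [pi pih piE] : exists2 pi : 'Hom(P0, P2), is_rhom pi & (i \o pi)%VF = e'.
  by apply: rhom_factor_inj; rewrite ?iE ?subvv.
have ipi x : i (pi x) = e' x by rewrite -comp_lfunE piE.
have iinj x y : i x = i y -> x = y by apply/lker0P; rewrite i0.
have e'i x : e' (i x) = i x.
  have /mem_limg[y <-] : i x \in limg e' by rewrite -iE; apply/mem_limg; exists x.
  exact: e'e'.
have pii x : pi (i x) = x by apply: iinj; rewrite ipi e'i.
have injP2 : rinjective P2.
  apply: summ; last exact: (projective_summand ih pih pii).
  exists (p \o i)%VF, (pi \o sp)%VF; split; [exact: rhom_comp | exact: rhom_comp |].
  apply/lfunP=> x; rewrite !comp_lfunE id_lfunE -[sp _]comp_lfunE spE.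
  by rewrite e'i pii.
move=> X Y g a gh ah g0.
have [h1 h1h h1E] := injP2 _ _ g (pi \o a)%VF gh (rhom_comp ah pih) g0.
have uta : is_rhom (u \o (t \o a))%VF by do 2?apply: rhom_comp => //.
have [h2 h2h h2E] := injQ _ _ g _ gh uta g0.
exists ((i \o h1)%VF + (r \o h2)%VF).
  by rewrite -[(i \o h1)%VF]scale1r; apply: rhom_lin; apply: rhom_comp.
apply/lfunP=> x; rewrite comp_lfunDl add_lfunE -!comp_lfunA h1E h2E !comp_lfunE.
by rewrite ipi -[r _]comp_lfunE -wu wt e'E subrK.
Qed.

End ProjectiveInjectiveSummands.

Section Main.
Variables (K : fieldType) (A : falgType K) (nk : nakayama_datum A).
Implicit Types M P X Y : rmodule A.

Notation Q := (nk_mod nk).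
Notation rel := (nk_rel nk).

Lemma torsionless_proj P : rprojective P -> torsionless Q P.
Proof. exact/torsionless_projective/nk_torsionless. Qed.

Lemma reflexive_proj P : rprojective P -> reflexive_wrt Q P.
Proof. exact/reflexive_projective/nk_reflexive. Qed.

Lemma projective_injective_retract P : rprojective P -> rinjective P ->
  exists n (j : 'Hom(P, rpow n Q)) (r : 'Hom(rpow n Q, P)),
    [/\ is_rhom j, is_rhom r & (r \o j)%VF = \1%VF].
Proof.
move=> projP injP.
have [n [m [j [d [jh dh j0 _]]]]] :=
  copresentation_of_reflexive (reflexive_proj projP) (torsionless_proj projP).
have [r rh rj] := injP _ _ j \1%VF jh (@rhom_id _ _ P) j0.
by exists n, j, r.
Qed.

(** Projective-injective modules are retracts of powers of Q, and nk_rel is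
    natural. *)
Lemma rel_lift P (u : 'Hom(P, rregular A)) :
  rprojective P -> rinjective P -> is_rhom u -> exists g, rel g u.
Proof.
move=> projP injP uh; have [n [j [r [jh rh rj]]]] := projective_injective_retract projP injP.
have [g gE] := nk_rpow_exists (rhom_comp rh uh).
exists (g \o j)%VF; have := nk_comp jh gE.
by rewrite -comp_lfunA rj comp_lfun1r.
Qed.

Lemma rel_eq0 P (g : 'Hom(P, K^o)) :
  rprojective P -> rinjective P -> rel g 0 -> g = 0.
Proof.
move=> projP injP g0; have [n [j [r [jh rh rj]]]] := projective_injective_retract projP injP.
have := nk_comp rh g0; rewrite comp_lfun0l => /nk_rpow_inj gr.
by rewrite -[g]comp_lfun1r -rj comp_lfunA gr comp_lfun0l.
Qed.

(** On projective-injective modules Hom(-, A) and D are naturally isomorphic,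
    so the transpose of M, the cokernel of Hom(f, A), is the cokernel of D(f),
    that is the dual of the second syzygy ker f. *)
Lemma tau_of_proj_inj_presented M : proj_inj_presented M ->
  exists X Y : rmodule A, [/\ is_tau M X, is_syzygy 2 M Y & rmod_iso X Y].
Proof.
move=> [P0 [P1 [p [f [[cover [projP1 fh fp sup]] [inj0 inj1]]]]]].
have [projP0 ph p1 supp] := cover.
have [Y [i [ih i0 iE]]] := submodule_embedding (submodule_lker fh).
(* S is the graph of Hom(P1, A) = D(P1) -> D(Y), which becomes the cokernel map. *)
pose S (h : homA P1) (l : rdual Y) :=
  exists2 g, rel g (vsval h) & (l : 'Hom(Y, K^o)) = (g \o i)%VF.
have S0 l : S 0 l -> l = 0.
  move=> [g]; rewrite linear0 => /(rel_eq0 projP1 inj1)-> ->.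
  by rewrite comp_lfun0l.
have Slin c h l h' l' : S h l -> S h' l' -> S (c *: h + h') (c *: l + l').
  move=> [g gh ->] [g' gh' ->]; exists (c *: g + g'); first by rewrite homA_lin; apply: nk_lin.
  by rewrite comp_lfunDl -comp_lfunZl.
have [|| q qh qS] := @rhom_of_rel _ _ (homA P1) (rdual Y) S _ S0 Slin.
- move=> h; have [g gh] := rel_lift projP1 inj1 (homA_hom h).
  by exists (g \o i)%VF, g.
- move=> h l a [g gh ->]; exists (g \o racto P1 (a : A))%VF.
    by apply: (nk_act gh) => x; apply: homA_ract.
  by apply/lfunP=> y; rewrite !comp_lfunE !ractoE ih.
have qE h l : S h l -> q h = l.
  move=> hl; apply/eqP; rewrite eq_sym -subr_eq0; apply/eqP/S0.
  by have := Slin (-1) _ _ _ _ (qS h) hl; rewrite !scaleN1r addNr addrC.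
have transp : is_transpose M (rdual Y).
  exists P0, P1, p, f, q; split=> //; split=> //.
    apply/limg_fullP => l.
    have [|g gE] := @hom_extend _ _ _ _ i (l : 'Hom(Y, K^o)); first by rewrite i0 sub0v.
    have [u uh ug] := nk_exists nk g; exists (homA_of u); apply: qE.
    by exists g; rewrite ?homA_ofE.
  move=> h; split=> [qh0 | [g0 hE]].
    have [g gh] := qS h; rewrite qh0 => /esym gi.
    have [|g' gE] := @hom_extend _ _ _ _ f g.
      rewrite -iE; apply/subvP=> _ /mem_limg[y <-].
      by rewrite memv_ker -comp_lfunE gi zero_lfunE.
    have [u uh ug] := nk_exists nk g'; exists (homA_of u); rewrite homA_ofE //.
    by apply: nk_uniq gh _; rewrite gE; apply: nk_comp.
  have [g gh] := rel_lift projP0 inj0 (homA_hom g0).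
  apply: qE; exists (g \o f)%VF; first by rewrite hE; apply: nk_comp.
  apply/lfunP=> y; rewrite !comp_lfunE zero_lfunE.
  have : i y \in lker f by rewrite -iE; apply/mem_limg; exists y.
  by rewrite memv_ker => /eqP->; rewrite linear0.
exists (of_opop (rdual (rdual Y))), Y; split.
- by exists (rdual Y) => //; apply: rmod_iso_refl.
- have [Y1 [i1 [i1h i10 i1E]]] := submodule_embedding (submodule_lker ph).
  have [f1 f1h f1E] : exists2 f1 : 'Hom(P1, Y1), is_rhom f1 & (i1 \o f1)%VF = f.
    by apply: rhom_factor_inj; rewrite ?i1E ?fp ?subvv.
  have f1ker : lker f1 = lker f.
    apply/vspaceP=> x; rewrite !memv_ker -f1E comp_lfunE.
    by apply/eqP/eqP=> [-> | /(lker0_inj i10)//]; rewrite linear0.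
  have f1full : limg f1 = fullv.
    apply/limg_fullP => y.
    have : i1 y \in limg f by rewrite fp -i1E; apply/mem_limg; exists y.
    move=> /mem_limg[x xy]; exists x; apply/eqP; rewrite -subr_eq0; apply/eqP.
    by apply: (lker0_inj i10); rewrite linearB /= -comp_lfunE f1E xy subrr.
  exists Y1.
    exists M; first exact: rmod_iso_refl.
    by exists P0, p, i1.
  by exists P1, f1, i; split; rewrite ?f1ker //; split; rewrite ?f1ker.
- have d1 := dual_of_flip (duality_op A) (dual_of_rdual Y).
  have d2 := dual_of_opop_rdual (rdual Y).
  exact: dual_of_unique (duality_sym (duality_op A)) d2 d1.
Qed.

(** Y is the kernel of a map between projective modules, so it inherits
    reflexivity with respect to Q from the regular module. *)
Lemma second_syzygy_copresented M Y : is_syzygy 2 M Y ->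
  exists n m (j : 'Hom(Y, rpow n Q)) (d : 'Hom(rpow n Q, rpow m Q)),
    [/\ is_rhom j, is_rhom d, lker j = 0%VS & lker d = limg j].
Proof.
move=> [Y1 [Y0 _ [P0 [p0 [i0 [[projP0 _ _ _] i0h i00 _]]]]]].
move=> [P1 [p1 [i1 [[projP1 p1h _ _] i1h i10 i1E]]]].
have ker : limg i1 = lker (i0 \o p1)%VF.
  rewrite i1E; apply/vspaceP=> x; rewrite !memv_ker comp_lfunE.
  by apply/eqP/eqP=> [-> | /(lker0_inj i00)//]; rewrite linear0.
apply: copresentation_of_reflexive; last first.
  exact: torsionless_sub i1h i10 (torsionless_proj projP1).
exact (reflexive_kernel (@nk_injective _ _ nk) i1h (rhom_comp p1h i0h) i10 ker
         (reflexive_proj projP1) (torsionless_proj projP0)).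
Qed.

(** Both Hom(P1, A) -> T and Hom(Q^n, A) = D(Q^n) -> D(Y) = T present the
    transpose T by projective left modules. Comparing them gives
    h0 : P1 -> Q^n and k0 : Q^n -> P1 with 1 - k0 h0 = l f. As the image of f is
    superfluous, 1 - f l and with it 1 - l f = k0 h0 is invertible, so P1 is a
    summand of Q^n. The comparison on kernels gives f k0 = k1 d and d h0 = h1 f,
    whence (1 - f l) f = f k0 h0 = k1 h1 f, and f is fixed by the endomorphism
    (1 - f l)^-1 k1 h1 of P0. *)
Lemma proj_inj_presented_of_tau M :
    (forall P : rmodule A, rsummand P M -> rprojective P -> rinjective P) ->
    (exists X Y : rmodule A, [/\ is_tau M X, is_syzygy 2 M Y & rmod_iso X Y]) ->
  proj_inj_presented M.
Proof.
move=> summ [X [Y [[T [P0 [P1 [p [f [q [cover pres [qh q1 qker]]]]]]] XT] syz XY]]].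
have [projP1 fh fp sup] := pres; have [projP0 ph p1 supp] := cover.
have [n [m [j [d [jh dh j0 jd]]]]] := second_syzygy_copresented syz.
have [c cP] : dual_of (id : A -> A^c) Y T.
  apply: dual_of_iso XY; apply: dual_of_iso (rmod_iso_sym XT).
  exact: dual_of_flip (duality_sym (duality_op A)) (dual_of_opop_rdual T).
have [cl cr cs c1 c2] := cP.
(* S is the graph of the surjection Hom(Q^n, A) = D(Q^n) -> D(Y) = T. *)
pose S (v : 'Hom(rpow n Q, rregular A)) (tau : T) :=
  exists2 g, rel g v & forall y, g (j y) = c y tau.
have S_lin k v tau v' tau' :
    S v tau -> S v' tau' -> S (k *: v + v') (k *: tau + tau').
  move=> [g gv gc] [g' gv' gc']; exists (k *: g + g'); first exact: nk_lin.
  by move=> y; rewrite add_lfunE scale_lfunE gc gc' cr.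
have S_act v tau (v' : 'Hom(rpow n Q, rregular A)) (a : A) :
    S v tau -> (forall x, (v' x : A) = a * (v x : A)) ->
    S v' (tau *> (a : A^c)).
  move=> [g gv gc] v'E; exists (g \o racto _ a)%VF; first exact: nk_act gv v'E.
  by move=> y; rewrite comp_lfunE ractoE -jh gc cs.
have c0 y : c y 0 = 0 by exact: (pairing0r _ cP).
have S_zero v : S v 0 -> exists2 u : 'Hom(rpow m Q, rregular A), is_rhom u & v = (u \o d)%VF.
  move=> [g gv gj].
  have [|g' gE] := @hom_extend _ _ _ _ d g.
    rewrite jd; apply/subvP=> _ /mem_limg[y <-].
    by rewrite memv_ker gj c0.
  have [u uh ug] := nk_exists nk g'; exists u => //.
  by apply: nk_uniq gv _; rewrite gE; apply: nk_comp.
have S_comp (u : 'Hom(rpow m Q, rregular A)) : is_rhom u -> S (u \o d)%VF 0.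
  move=> uh; have [g gu] := nk_rpow_exists uh; exists (g \o d)%VF; first exact: nk_comp.
  move=> y; rewrite comp_lfunE c0.
  have : j y \in lker d by rewrite jd; apply/mem_limg; exists y.
  by rewrite memv_ker => /eqP->; rewrite linear0.
have S00 : S 0 0.
  by have := S_comp _ (@rhom0 _ _ (rpow m Q) (rregular A)); rewrite comp_lfun0l.
have S_uniq v tau tau' : S v tau -> S v tau' -> tau = tau'.
  move=> h h'; apply/eqP; rewrite -subr_eq0; apply/eqP.
  have := S_lin (-1) _ _ _ _ h' h; rewrite !scaleN1r addNr addrC => - [g g0 gc].
  by apply: c2 => y; rewrite -gc (nk_rpow_inj g0) zero_lfunE.
have S_surj tau : exists v, is_rhom v /\ S v tau.
  have ctl : linear (c^~ tau) by apply: cl.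
  have [|g gE] := @hom_extend _ _ _ _ j (linfun (c^~ tau) : 'Hom(Y, K^o)).
    by rewrite j0 sub0v.
  have [v vh gv] := nk_exists nk g; exists v; split=> //; exists g => // y.
  by rewrite -comp_lfunE -gE linfunE.
have S_comb r (v : 'I_r -> 'Hom(rpow n Q, rregular A)) tau (a : 'I_r -> A)
    (w : 'Hom(rpow n Q, rregular A)) :
    (forall i, S (v i) (tau i)) ->
    (forall x, (w x : A) = \sum_i a i * (v i x : A)) ->
    S w (\sum_i tau i *> (a i : A^c)).
  move=> Sv wE.
  have vi i : exists w' : 'Hom(rpow n Q, rregular A), forall x, (w' x : A) = a i * (v i x : A).
    have l : linear (fun x : rpow n Q => a i * (v i x : A) : rregular A).
      by move=> k x y; rewrite linearP mulrDr scalerAr.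
    by exists (linfun (fun x : rpow n Q => a i * (v i x : A) : rregular A)) => x;
      rewrite linfunE.
  have /fin_all_exists[w' w'E] := vi.
  have -> : w = \sum_i w' i.
    by apply/lfunP=> x; rewrite sum_lfunE [LHS]wE; apply: eq_bigr => i _; rewrite w'E.
  elim: (index_enum _) => [|i l IH]; first by rewrite !big_nil.
  rewrite !big_cons -[w' i]scale1r -[_ *> _]scale1r; apply: S_lin => //.
  exact: S_act (Sv i) (w'E i).
have q_comb r (h : 'I_r -> homA P1) (a : 'I_r -> A) (h' : homA P1) :
    (forall x, (vsval h' x : A) = \sum_i a i * (vsval (h i) x : A)) ->
    q h' = \sum_i q (h i) *> (a i : A^c).
  move=> h'E.
  have -> : h' = \sum_i h i *> (a i : A^c).
    apply: homA_inj => x; rewrite homA_sum [LHS]h'E; apply: eq_bigr => i _.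
    by rewrite homA_ract.
  by rewrite linear_sum; apply: eq_bigr => i _; apply: qh.
have [k0 k0h k0P] : exists2 k0 : 'Hom(rpow n Q, P1), is_rhom k0 &
    forall h : homA P1, S (vsval h \o k0)%VF (q h).
  have [r [x [g [gh gE]]]] := dual_basis projP1.
  have /fin_all_exists[v vP] : forall i, exists v, is_rhom v /\ S v (q (homA_of (g i))).
    by move=> i; apply: S_surj.
  have [k0 k0h k0E] := rhom_expansion x (fun i => (vP i).1); exists k0 => // h.
  have hE y : (vsval h (\sum_i x i *> (y i : A)) : A) = \sum_i (vsval h (x i) : A) * y i.
    by rewrite linear_sum; apply: eq_bigr => i _; rewrite /= (homA_hom h).
  rewrite (q_comb _ (fun i => homA_of (g i)) (fun i => vsval h (x i))).
    by apply: S_comb (fun i => (vP i).2) _ => z; rewrite comp_lfunE k0E hE.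
  by move=> y; rewrite {1}(gE y) hE; apply: eq_bigr => i _; rewrite homA_ofE.
have [h0 h0h h0P] : exists2 h0 : 'Hom(P1, rpow n Q), is_rhom h0 &
    forall v : 'Hom(rpow n Q, rregular A), is_rhom v -> S v (q (homA_of (v \o h0)%VF)).
  have [r [x [g [gh gE]]]] := dual_basis (@projective_rpow _ _ n Q (@nk_projective _ _ nk)).
  have /fin_all_exists[h hP] : forall i, exists h, S (g i) (q h).
    move=> i; have [g' gg'] := nk_rpow_exists (gh i).
    have jl : linear (fun y : Y => g' (j y)) by move=> k y y'; rewrite !linearP.
    have [tau tauE] := dual_represent (t := (id : A^c -> A)) (fun=> erefl)
      (linfun (fun y : Y => g' (j y)) : 'Hom(Y, K^o)) cP.
    have [h hE] := (limg_fullP q).1 q1 tau; exists h, g' => // y.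
    by rewrite hE -tauE linfunE.
  have [h0 h0h h0E] := rhom_expansion x (fun i => homA_hom (h i)); exists h0 => // v vh.
  have vE (y : 'I_r -> A) : (v (\sum_i x i *> y i) : A) = \sum_i (v (x i) : A) * y i.
    by rewrite linear_sum; apply: eq_bigr => i _; rewrite /= vh.
  rewrite (q_comb _ h (fun i => v (x i))).
    by apply: S_comb hP _ => z; rewrite {1}(gE z) vE.
  by move=> z; rewrite homA_ofE; [rewrite comp_lfunE h0E vE | apply: rhom_comp].
have qeq (h : homA P1) : q h = 0 ->
    exists2 u : 'Hom(P0, rregular A), is_rhom u & vsval h = (u \o f)%VF.
  by move=> /qker[g ->]; exists (vsval g) => //; apply: homA_hom.
have [l lh lE] : exists2 l : 'Hom(P0, P1), is_rhom l & (\1 - (k0 \o h0))%VF = (l \o f)%VF.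
  apply: projective_factor => // u uh.
  have ukh : is_rhom ((u \o k0) \o h0)%VF by do 2?apply: rhom_comp.
  have [|g gh gE] := qeq (homA_of u - homA_of ((u \o k0) \o h0)%VF).
    rewrite linearB /=; apply/eqP; rewrite subr_eq0; apply/eqP.
    have := k0P (homA_of u); rewrite homA_ofE // => /S_uniq; apply.
    by apply: h0P; apply: rhom_comp.
  exists g => //; rewrite -gE linearB /= !homA_ofE //.
  by apply/lfunP=> x; rewrite !(add_lfunE, opp_lfunE, comp_lfunE, id_lfunE) linearB.
have [k1 k1h k1E] : exists2 k1 : 'Hom(rpow m Q, P0), is_rhom k1 & (f \o k0)%VF = (k1 \o d)%VF.
  apply: projective_factor => // u uh; apply: S_zero.
  have ufh := rhom_comp fh uh.
  have <- : q (homA_of (u \o f)%VF) = 0.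
    by apply/qker; exists (homA_of u); rewrite !homA_ofE.
  by have := k0P (homA_of (u \o f)%VF); rewrite homA_ofE // -comp_lfunA.
have [h1 h1h h1E] : exists2 h1 : 'Hom(P0, rpow m Q), is_rhom h1 & (d \o h0)%VF = (h1 \o f)%VF.
  apply: projective_factor => [|u uh]; first exact/projective_rpow/nk_projective.
  have udh : is_rhom ((u \o d) \o h0)%VF by do 2?apply: rhom_comp.
  have [|g gh gE] := qeq (homA_of ((u \o d) \o h0)%VF).
    by apply: S_uniq (h0P _ (rhom_comp dh uh)) (S_comp _ uh).
  by exists g => //; rewrite -gE homA_ofE // comp_lfunA.
(* p e = p, so the superfluous kernel of p makes e surjective. *)
pose e : 'End(P0) := (\1 - (f \o l))%VF.
have eE x : e x = x - f (l x) by rewrite /e add_lfunE opp_lfunE id_lfunE comp_lfunE.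
have eh : is_rhom e by apply: rhomB; [apply: rhom_id | apply: rhom_comp].
have pf x : p (f x) = 0.
  by apply/eqP; rewrite -memv_ker -fp; apply/mem_limg; exists x.
have e1 : limg e = fullv.
  apply: ((superfluousP ph).1 supp _ _ eh).
  suff -> : (p \o e)%VF = p by rewrite subvv.
  by apply/lfunP=> x; rewrite comp_lfunE eE linearB /= pf subr0.
have e0 := (lker0_full e).2 e1.
have khE x : k0 (h0 x) = x - l (f x).
  have /lfunP/(_ x) := lE; rewrite add_lfunE opp_lfunE id_lfunE !comp_lfunE => <-.
  by rewrite subKr.
have kh0 : lker (k0 \o h0)%VF = 0%VS.
  apply: inj_lker0 => x; rewrite comp_lfunE khE => /eqP; rewrite subr_eq0 => /eqP xE.
  suff fx : f x = 0 by rewrite xE fx linear0.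
  by apply: (lker0_inj e0); rewrite eE -xE subrr.
have kh1 := (lker0_full _).1 kh0.
have khh : is_rhom (k0 \o h0)%VF by apply: rhom_comp.
have injP1 : rinjective P1.
  apply: (@injective_summand _ _ P1 (rpow n Q) h0 ((k0 \o h0)^-1 \o k0)%VF) => //.
  - by apply: rhom_comp => //; apply: rhom_inv.
  - by move=> x; rewrite comp_lfunE -[k0 _]comp_lfunE lker0_lfunK ?kh0.
  - exact/injective_rpow/nk_injective.
have injP0 : rinjective P0.
  apply: (@injective_of_factor _ _ M P0 P1 (rpow m Q) p f (e^-1 \o k1)%VF h1) => //.
  - exact/injective_rpow/nk_injective.
  - by apply: rhom_comp => //; apply: rhom_inv.
  - apply/lfunP=> x; rewrite !comp_lfunE -[h1 _]comp_lfunE -h1E comp_lfunE.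
    rewrite -[k1 _]comp_lfunE -k1E comp_lfunE khE linearB /= -eE.
    by rewrite lker0_lfunK ?e0.
by exists P0, P1, p, f; split.
Qed.

End Main.

(** * The opposite algebra *)

Section Opposite.
Variables (K : fieldType) (B : falgType K).

Lemma symmetric_op : symmetric_alg B -> symmetric_alg B^c.
Proof.
move=> [psi [psi0 psi1 psiE]]; exists (psi : 'Hom(B^c, 'Hom(B^c, K^o))).
split=> // a b x y.
have e := psiE (b : B) (a : B) (x : B) (y : B); rewrite -!mulrA in e; exact: e.
Qed.

(** Evaluations at elements of N are homomorphisms from D(N) = Hom_B(N, B) to B,
    and together they reach the unit of B because N is a generator. *)
Lemma generator_op (N : rmodule B) :
  symmetric_alg B -> generator N -> generator (rdual N).
Proof.
move=> /symmetric_trace[tr [trC tr_rep tr_nd]] /generator_partition[k [gu [gn [guh gu1]]]] X.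
pose H := homv (rdual N) X.
exists (\dim H), (fun i => (vbasis H)`_i); split=> [i|].
  by apply/homvP/vbasis_mem/mem_nth; rewrite size_tuple.
pose R n (xi : rdual N) (x : rregular B^c) :=
  forall b : B, tr ((x : B) * b) = (xi : 'Hom(N, K^o)) (n *> b).
have R0 n (x : rregular B^c) : R n 0 x -> x = 0.
  by move=> Rx; apply: (tr_nd (x : B)) => b; rewrite Rx zero_lfunE.
have form n : exists2 F : 'Hom(rdual N, rregular B^c), is_rhom F & forall xi, R n xi (F xi).
  apply: rhom_of_rel (@R0 n) _ _.
  - move=> xi.
    have l : linear (fun b : B => (xi : 'Hom(N, K^o)) (n *> b)).
      by move=> c x y; rewrite ract_linr linearP.
    have [x xE] := tr_rep (linfun (fun b : B => (xi : 'Hom(N, K^o)) (n *> b))).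
    by exists (x : rregular B^c) => b; rewrite -xE linfunE.
  - move=> c xi x xi' x' e e' b.
    by rewrite mulrDl -scalerAl linearP /= e e' add_lfunE scale_lfunE.
  - move=> xi x b e y; rewrite -[(x *> b : rregular B^c)]/((b : B) * (x : B)).
    by rewrite -mulrA trC -mulrA e comp_lfunE ractoE ractM.
apply/eqP; rewrite eqEsubv subvf /=; apply/subvP=> x _.
have /fin_all_exists[h hP] : forall i : 'I_k, exists h : 'Hom(rdual N, X), is_rhom h /\
    h (tr \o gu i)%VF = x *> ((gu i (gn i) : B) : B^c).
  move=> i; have [F Fh FR] := form (gn i); have [o oh oE] := rhom_from_regular x.
  exists (o \o F)%VF; split; first exact: rhom_comp.
  rewrite comp_lfunE oE; congr (_ *> _); apply/eqP; rewrite -subr_eq0; apply/eqP.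
  apply: (@R0 (gn i)) => b; rewrite mulrBl linearB /= FR zero_lfunE comp_lfunE guh.
  by rewrite subrr.
have -> : x = \sum_i h i (tr \o gu i)%VF.
  rewrite -[LHS](ract1 x) -[1 : B^c]/((1 : B) : B^c) -gu1.
  rewrite -[X in _ *> X]/(\sum_i ((gu i (gn i) : B) : B^c)) ract_sumr.
  by apply: eq_bigr => i _; rewrite (hP i).2.
apply: memv_suml => i _.
have /homvP hH := (hP i).1.
rewrite (coord_vbasis hH) sum_lfunE; apply: memv_sumr => j _.
by rewrite scale_lfunE memvZ // memv_img ?memvf.
Qed.

End Opposite.

(** D is a duality from right B-modules to right modules over the opposite
    algebra, so End(D(N)) is the opposite of End(N). *)
Lemma gendo_symmetric_op (K : fieldType) (A : falgType K) :
  gendo_symmetric A -> gendo_symmetric A^c.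
Proof.
move=> [B [N [symB genN [phi [phi_lin phi_inj [phi1 phiM] phi_onto]]]]].
exists B^c, (rdual N); split; [exact: symmetric_op | exact: generator_op |].
pose tphi (a : A^c) : 'End(rdual N) :=
  linfun (fun xi : rdual N => ((xi : 'Hom(N, K^o)) \o phi (a : A))%VF : rdual N).
have tphiE (a : A^c) (xi : rdual N) n :
    (tphi a xi : 'Hom(N, K^o)) n = (xi : 'Hom(N, K^o)) (phi (a : A) n).
  rewrite linfunE ?comp_lfunE // => c f g.
  by rewrite comp_lfunDl -comp_lfunZl.
exists tphi; split.
- move=> c a b; apply/lfunP=> xi; apply/lfunP=> n.
  rewrite !(add_lfunE, scale_lfunE, tphiE).
  by rewrite [phi _]phi_lin add_lfunE scale_lfunE linearP.
- move=> a b e; apply: phi_inj; apply/lfunP=> n; apply/eqP; rewrite -subr_eq0.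
  apply/eqP/separate0 => xi; rewrite linearB /=.
  by rewrite -(tphiE a xi) -(tphiE b xi) e subrr.
- split=> [|a b]; apply/lfunP=> xi; apply/lfunP=> n.
    by rewrite tphiE id_lfunE [phi _]phi1 id_lfunE.
  by rewrite comp_lfunE !tphiE [phi _]phiM comp_lfunE.
move=> f; split=> [fh | [a ->]].
  have bP := dual_pairing_flip (t := (id : B^c -> B)) (fun=> erefl) (rdual_pairing N).
  have [g gh fg] := adjoint_exists (t := (id : B -> B^c)) (fun=> erefl) bP bP fh.
  have [a aE] := (phi_onto g).1 gh; exists (a : A^c).
  by apply/lfunP=> xi; apply/lfunP=> n; rewrite tphiE -aE; apply: fg.
move=> xi b; apply/lfunP=> n.
have ph : is_rhom (phi (a : A)) by apply/phi_onto; exists (a : A).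
by rewrite tphiE !comp_lfunE !ractoE tphiE ph.
Qed.

(** * Dominant dimension, codominant dimension and translates *)

Section DominantDimension.
Variables (K : fieldType) (A : falgType K).
Implicit Types M X Y : rmodule A.

Lemma codomdim_ge2P M : codomdim_ge M 2 <-> proj_inj_presented M.
Proof.
have D := duality_op A; have dM := dual_of_rdual M.
rewrite /codomdim_ge domdim_ge2P; split.
  exact: proj_inj_presented_dual (duality_sym D) (dual_of_flip D dM).
exact: proj_inj_copresented_dual D dM.
Qed.

Lemma codomdim_ge2_tau M :
    gendo_symmetric A ->
    (forall P : rmodule A, rsummand P M -> rprojective P -> rinjective P) ->
  codomdim_ge M 2 <->
    exists X Y : rmodule A, [/\ is_tau M X, is_syzygy 2 M Y & rmod_iso X Y].
Proof.
move=> /gendo_symmetric_datum[nk] summ.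
split=> [/codomdim_ge2P | tau]; first exact: (tau_of_proj_inj_presented nk).
exact/codomdim_ge2P/(proj_inj_presented_of_tau nk).
Qed.

End DominantDimension.

Lemma rsummand_dual (K : fieldType) (A A' : falgType K) (s : A -> A') (t : A' -> A)
    (M P : rmodule A) (L I : rmodule A') :
    duality s t -> dual_of s M L -> dual_of s P I ->
  rsummand P M -> rsummand I L.
Proof.
move=> [st ts _ _] [b bP] [c cP] [i [r [ih rh ri]]].
have [i' i'h ii'] := adjoint_exists ts cP bP ih.
have [r' r'h rr'] := adjoint_exists ts bP cP rh.
exists r', i'; split=> //.
have a := adjoint_comp ii' rr'; rewrite ri in a.
exact: adjoint_unique cP a (adjoint_id c).
Qed.

Section InverseTranslate.
Variables (K : fieldType) (A : falgType K).
Implicit Types M X Y : rmodule A.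

Lemma domdim_ge2_dual M : domdim_ge M 2 <-> codomdim_ge (rdual M) 2.
Proof.
have D := duality_op A; have dM := dual_of_rdual M.
rewrite codomdim_ge2P domdim_ge2P; split.
  exact: proj_inj_presented_dual D dM.
exact: proj_inj_copresented_dual (duality_sym D) (dual_of_flip D dM).
Qed.

Lemma dual_of_opop_opop (T : rmodule A^c^c) :
  dual_of (id : A -> A^c) (of_opop T) (of_opop (rdual T)).
Proof.
exists (fun (m : of_opop T) (phi : of_opop (rdual T)) => (phi : 'Hom(T, K^o)) m); split.
- by move=> l k x y; rewrite linearP.
- by move=> m k x y; rewrite add_lfunE scale_lfunE.
- by move=> m a l; rewrite comp_lfunE ractoE.
- exact: separate0.
- by move=> l h; apply/lfunP=> m; rewrite h zero_lfunE.
Qed.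

Lemma tau_inv_cosyzygy_dual M :
  (exists X Y : rmodule A, [/\ is_tau_inv M X, is_cosyzygy 2 M Y & rmod_iso X Y]) <->
  (exists X Y : rmodule A^c, [/\ is_tau (rdual M) X, is_syzygy 2 (rdual M) Y & rmod_iso X Y]).
Proof.
have D := duality_op A; have D' := duality_sym D; have dM := dual_of_rdual M.
split=> [[X [Y [[T trT XT] cosyz XY]]] | [X [Y [[T trT XT] syz XY]]]].
  have dT := dual_of_opop_opop T.
  have dY := dual_of_iso (dual_of_iso dT (rmod_iso_sym XT)) XY.
  exists (of_opop (rdual T)), (rdual Y); split.
  - by exists T => //; apply: rmod_iso_refl.
  - exact: syzygy_dual D dM (dual_of_rdual Y) cosyz.
  - exact: dual_of_unique D dY (dual_of_rdual Y).
have dT := dual_of_flip D (dual_of_opop_opop T).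
have dY := dual_of_iso (dual_of_iso dT (rmod_iso_sym XT)) XY.
exists (of_opop T), (of_opop (rdual Y)); split.
- by exists T => //; apply: rmod_iso_refl.
- exact: cosyzygy_dual D' (dual_of_flip D dM) (dual_of_opop_rdual Y) syz.
- exact: dual_of_unique D' dY (dual_of_opop_rdual Y).
Qed.

Lemma domdim_ge2_tau_inv M :
    gendo_symmetric A ->
    (forall I : rmodule A, rsummand I M -> rinjective I -> rprojective I) ->
  domdim_ge M 2 <->
    exists X Y : rmodule A, [/\ is_tau_inv M X, is_cosyzygy 2 M Y & rmod_iso X Y].
Proof.
move=> /gendo_symmetric_op gendo summ.
have D := duality_op A; have D' := duality_sym D; have dM := dual_of_rdual M.
have summ' (P : rmodule A^c) : rsummand P (rdual M) -> rprojective P -> rinjective P.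
  move=> sumP projP; have dP := dual_of_opop_rdual P.
  apply: (injective_dual D (dual_of_flip D' dP)); apply: summ.
    exact: rsummand_dual D' (dual_of_flip D dM) dP sumP.
  exact: injective_dual D' dP projP.
have [tau1 tau2] := codomdim_ge2_tau gendo summ'.
have [dual1 dual2] := domdim_ge2_dual M; have [tid1 tid2] := tau_inv_cosyzygy_dual M.
by split=> [/dual1/tau1/tid2 | /tid1/tau2/dual2].
Qed.

End InverseTranslate.

Theorem proposition4p3 (K : fieldType) (A : falgType K)
    (A_connected : connected_alg A)
    (A_nonsemisimple : ~ semisimple_alg A)
    (A_gendo : gendo_symmetric A)
    (M : rmodule A) :
  ((forall P : rmodule A, rsummand P M -> rprojective P -> rinjective P) ->
   (codomdim_ge M 2 <->
    exists X Y : rmodule A,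
      [/\ is_tau M X, is_syzygy 2 M Y & rmod_iso X Y]))
  /\
  ((forall I : rmodule A, rsummand I M -> rinjective I -> rprojective I) ->
   (domdim_ge M 2 <->
    exists X Y : rmodule A,
      [/\ is_tau_inv M X, is_cosyzygy 2 M Y & rmod_iso X Y])).
Proof.
split=> summ; first exact: codomdim_ge2_tau.
exact: domdim_ge2_tau_inv.
Qed.
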